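(* Let $\mathfrak{C}$ be an $(\!(n,k)\!)$ code with isometric encoding channel $\mathcal E$, let $d\ge1$, $\delta\ge0$, and let $\mathsf g$ be the complete graph on the $n$ qubits. Suppose either $$H_2\big(\varepsilon_{\mathsf g}(\mathfrak{C},d)/2+\delta/2\big)<k/n,$$ or $$H_2\big(2\max_{\mathcal N}\tilde\varepsilon(\mathcal N,\mathcal E)+\delta/2\big)<k/n,$$ where the maximum is over all replacement channels $\mathcal N$ acting on any $d$ qubits, and where the arguments of $H_2$ are less than $1/2$. Then every code state $|\psi\rangle\in\mathfrak{C}$ satisfies $\mathscr{C}^{\delta}(\psi)>\log d$.
   Context: An $(\!(n,k)\!)$ code is a $2^k$-dimensional subspace $\mathfrak{C}\subseteq(\mathbb{C}^2)^{\otimes n}$, $k<n$; $\Gamma=\Pi/2^k$. $\varepsilon_{\mathsf g}(\mathfrak{C},d)=\max\{\|\psi_S-\Gamma_S\|_1:|\psi\rangle\in\mathfrak{C}, |S|\le d\}$. A replacement channel on a set $S$ of qubits is $\sigma\mapsto(\mathrm{Tr}_S\sigma)\otimes\gamma$ for fixed $\gamma$ (identity elsewhere). QEC inaccuracy $\tilde\varepsilon(\mathcal N,\mathcal E)=\min_{\mathcal R}P(\mathcal R\circ\mathcal N\circ\mathcal E,\mathrm{id}_L)$, where $P(\mathcal M_1,\mathcal M_2)=\sqrt{1-F^2}$, $F=\min_\rho f((\mathcal M_1\otimes\mathrm{id})(\rho),(\mathcal M_2\otimes\mathrm{id})(\rho))$, $f(\rho,\sigma)=\|\sqrt\rho\sqrt\sigma\|_1$.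 $\mathscr{C}^\delta(\psi)$ is the minimum over pure $\psi'$ with $\|\psi'-\psi\|_1\le\delta$ of the minimum depth of a circuit of layers of disjoint arbitrary 2-qubit gates preparing $|\psi'\rangle$ from $|0\rangle^{\otimes n}$. Logs base 2; $H_2$ binary entropy. *)

(* Defs.v *)
From HB Require Import structures.
From Stdlib Require Import ClassicalEpsilon.
From mathcomp Require Import all_boot all_order all_algebra.
From mathcomp Require Import complex.
From mathcomp Require Import boolp classical_sets reals constructive_ereal ereal exp.

Set Implicit Arguments.
Unset Strict Implicit.
Unset Printing Implicit Defensive.
Import Order.TTheory GRing.Theory Num.Theory.
Local Open Scope ring_scope.
Local Open Scope classical_set_scope.

Section QInfo.
Variable R : realType.
Local Notation C := (R[i]).

Definition mat (X Y : finType) := X -> Y -> C.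
Definition vec (X : finType) := X -> C.

Definition mmul (X Y Z : finType) (A : mat X Y) (B : mat Y Z) : mat X Z :=
  fun x z => \sum_(y : Y) A x y * B y z.
Definition mapply (X Y : finType) (A : mat X Y) (v : vec Y) : vec X :=
  fun x => \sum_(y : Y) A x y * v y.
Definition adj (X Y : finType) (A : mat X Y) : mat Y X :=
  fun y x => Num.conj (A x y).
Definition msub (X Y : finType) (A B : mat X Y) : mat X Y := fun x y => A x y - B x y.
Definition mscale (X Y : finType) (c : C) (A : mat X Y) : mat X Y := fun x y => c * A x y.
Definition madd (X Y : finType) (A B : mat X Y) : mat X Y := fun x y => A x y + B x y.
Definition idm (X : finType) : mat X X := fun x y => (x == y)%:R.
Definition mtr (X : finType) (A : mat X X) : C := \sum_(x : X) A x x.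

Definition psd (X : finType) (A : mat X X) : Prop :=
  forall v : vec X, 0 <= \sum_(x : X) \sum_(y : X) Num.conj (v x) * A x y * v y.
Definition density (X : finType) (rho : mat X X) : Prop := psd rho /\ mtr rho = 1.
Definition qisometry (X Y : finType) (V : mat X Y) : Prop :=
  forall y y', mmul (adj V) V y y' = @idm Y y y'.
Definition qunitary (X : finType) (U : mat X X) : Prop :=
  qisometry U /\ (forall x x', mmul U (adj U) x x' = @idm X x x').
Definition unit_vec (X : finType) (v : vec X) : Prop :=
  \sum_(x : X) Num.conj (v x) * v x = 1.
Definition proj (X : finType) (v : vec X) : mat X X := fun x y => v x * Num.conj (v y).

(* the positive square root of a psd operator (the unique psd P with P P = A) *)
Definition msqrt (X : finType) (A : mat X X) : mat X X :=
  epsilon (inhabits (fun _ _ => 0 : C))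
    (fun P : mat X X => psd P /\ (forall x y, mmul P P x y = A x y)).

Definition trnorm (X Y : finType) (A : mat X Y) : R :=
  complex.Re (mtr (msqrt (mmul (adj A) A))).

Definition fid (X : finType) (rho sigma : mat X X) : R :=
  trnorm (mmul (msqrt rho) (msqrt sigma)).

Definition chan (X Y : finType) := mat X X -> mat Y Y.

(* (M \otimes id_Z) *)
Definition ext (X Y Z : finType) (M : chan X Y) (rho : mat (X * Z)%type (X * Z)%type)
  : mat (Y * Z)%type (Y * Z)%type :=
  fun p q => M (fun x x' => rho (x, p.2) (x', q.2)) p.1 q.1.

Definition cptp (X Y : finType) (M : chan X Y) : Prop :=
  (forall (c : C) (A B : mat X X) y y',
      M (madd (mscale c A) B) y y' = c * M A y y' + M B y y') /\
  (forall A : mat X X, mtr (M A) = mtr A) /\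
  (forall (Z : finType) (rho : mat (X * Z)%type (X * Z)%type), psd rho -> psd (ext M rho)).

Definition chan_fid (X Y : finType) (M1 M2 : chan X Y) : R :=
  inf [set fid (ext M1 rho) (ext M2 rho) | rho in [set rho : mat (X * X)%type (X * X)%type | density rho]].

Definition pdist (X Y : finType) (M1 M2 : chan X Y) : R :=
  Num.sqrt (1 - chan_fid M1 M2 ^+ 2).

Definition qec_inacc (L P : finType) (N : chan P P) (E : chan L P) : R :=
  inf [set pdist (fun rho => Rc (N (E rho))) (fun rho => rho)
      | Rc in [set Rc : chan P L | cptp Rc]].

Definition qb (n : nat) := {ffun 'I_n -> bool}.
Definition subq (n : nat) (S : {set 'I_n}) := {ffun {i : 'I_n | i \in S} -> bool}.
Definition restr (n : nat) (S : {set 'I_n}) (x : qb n) : subq S :=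
  [ffun i => x (val i)].
Arguments restr {n} S x.

(* reduced operator on S : partial trace over the complement of S *)
Definition ptr (n : nat) (S : {set 'I_n}) (rho : mat (qb n) (qb n)) : mat (subq S) (subq S) :=
  fun a b => \sum_(x : qb n) \sum_(y : qb n)
    ([&& restr S x == a, restr S y == b & [forall i, (i \notin S) ==> (x i == y i)]])%:R
      * rho x y.
Arguments ptr {n} S rho _ _.

Definition repl (n : nat) (S : {set 'I_n}) (gamma : mat (subq S) (subq S)) : chan (qb n) (qb n) :=
  fun rho x y => ptr (~: S) rho (restr (~: S) x) (restr (~: S) y) * gamma (restr S x) (restr S y).

Definition enc (k n : nat) (V : mat (qb n) (qb k)) : chan (qb k) (qb n) :=
  fun rho => mmul (mmul V rho) (adj V).

Definition code_state (k n : nat) (V : mat (qb n) (qb k)) (psi : vec (qb n)) : Prop :=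
  exists phi : vec (qb k), unit_vec phi /\ psi = mapply V phi.

Definition Gam (k n : nat) (V : mat (qb n) (qb k)) : mat (qb n) (qb n) :=
  mscale (2 ^+ k)^-1 (mmul V (adj V)).

(* epsilon_g(C,d) for g the complete graph: max over code states and |S| <= d *)
Definition eps_g (k n : nat) (V : mat (qb n) (qb k)) (d : nat) : R :=
  sup [set r : R | exists (psi : vec (qb n)) (S : {set 'I_n}),
      code_state V psi /\ (#|S| <= d)%N /\
      r = trnorm (msub (ptr S (proj psi)) (ptr S (Gam V)))].

Definition max_repl_inacc (k n : nat) (V : mat (qb n) (qb k)) (d : nat) : R :=
  sup [set r : R | exists (S : {set 'I_n}) (gamma : mat (subq S) (subq S)),
      (#|S| <= d)%N /\ density gamma /\ r = qec_inacc (repl gamma) (enc V)].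

Definition covered (n : nat) (P : {set ('I_n * 'I_n)%type}) (q : 'I_n) : bool :=
  [exists p in P, (p.1 == q) || (p.2 == q)].

Definition valid_pairs (n : nat) (P : {set ('I_n * 'I_n)%type}) : Prop :=
  (forall p, p \in P -> p.1 != p.2) /\
  (forall p p', p \in P -> p' \in P -> p != p' ->
     [&& p.1 != p'.1, p.1 != p'.2, p.2 != p'.1 & p.2 != p'.2]).

Definition layer_op (n : nat) (P : {set ('I_n * 'I_n)%type})
  (U : ('I_n * 'I_n)%type -> mat (bool * bool)%type (bool * bool)%type) : mat (qb n) (qb n) :=
  fun x y => (\prod_(p in P) U p (x p.1, x p.2) (y p.1, y p.2))
             * ([forall q, (~~ covered P q) ==> (x q == y q)])%:R.

Definition is_layer (n : nat) (L : mat (qb n) (qb n)) : Prop :=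
  exists (P : {set ('I_n * 'I_n)%type}) (U : ('I_n * 'I_n)%type -> mat (bool * bool)%type (bool * bool)%type),
    valid_pairs P /\ (forall p, p \in P -> qunitary (U p)) /\
    (forall x y, L x y = layer_op P U x y).

Definition zero_state (n : nat) : vec (qb n) := fun x => (x == [ffun => false])%:R.

Definition run (n : nat) (c : seq (mat (qb n) (qb n))) : vec (qb n) :=
  foldr (fun L v => mapply L v) (@zero_state n) c.

(* delta-approximate circuit complexity C^delta(psi) (in extended reals, +oo if no circuit) *)
Definition circ_cplx (n : nat) (delta : R) (psi : vec (qb n)) : \bar R :=
  ereal_inf [set ((size c)%:R)%:E
    | c in [set c : seq (mat (qb n) (qb n)) | (forall L, L \in c -> is_layer L) /\
             trnorm (msub (proj (run c)) (proj psi)) <= delta]].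

Definition log2 (x : R) : R := ln x / ln 2.
Definition H2 (p : R) : R := - p * log2 p - (1 - p) * log2 (1 - p).

End QInfo.

(* Main.v *)
Require Import Defs.
From HB Require Import structures.
From Stdlib Require Import ClassicalEpsilon.
From mathcomp Require Import all_boot all_order all_algebra.
From mathcomp Require Import complex.
From mathcomp Require Import unstable boolp classical_sets functions.
From mathcomp Require Import reals ereal exp.
From mathcomp Require Import ring lra.
Import Order.TTheory GRing.Theory Num.Theory.
Set Implicit Arguments.
Unset Strict Implicit.
Unset Printing Implicit Defensive.
Local Open Scope ring_scope.

(** Let [U] be a circuit of depth at most [log d] with [U |0>] close to the code state
    [psi], and let [W_i = U Z_i U^*]. Each [W_i] is a reflection supported on a light cone
    of at most [d] qubits and has expectation 1 in [U |0>], so its expectation in [Gam] is at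
    least [1 - 2 q], where [q] is the argument of [H2]. Hence the distribution
    [p x = <x| U^* Gam U |x>] has all its one-bit marginals at most [q]; since
    [p x <= 2 ^- k] pointwise, Gibbs' inequality against the product of Bernoulli([q])
    distributions gives [k <= n H2 q].

    In the first case the expectations of [W_i] in [psi] and [Gam] are compared by the duality
    [Re Tr (W A) <= |A|_1]. In the second case, recovery is tested on an entangled input with
    Schmidt weight 1/2 on the logical state of [psi], the other 1/2 being spread evenly over
    its complement. The recovered pair is nearly the pure input state, hence nearly
    uncorrelated with the lost qubits [S]; but the correlation of [W_i] on [S] with a sign
    observable on the reference is a multiple of [Tr W_i (psi - Gam)]. Choosing the input
    according to [psi] avoids any minimax argument. *)

Local Notation "A ** B" := (mmul A B) (at level 40, left associativity).
Local Notation Re := complex.Re.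
(* [rat] also defines a [subq]. *)
Local Notation subq := Defs.subq.

(** * Matrices over finite types *)

Section MatrixAlgebra.
Variable R : realType.
Local Notation C := (R[i]).
Implicit Types X Y Z T : finType.

Lemma sum_indicator (I : finType) (P : pred I) (F : I -> C) :
  \sum_i (P i)%:R * F i = \sum_(i | P i) F i.
Proof.
rewrite [RHS]big_mkcond; apply: eq_bigr => i _.
by case: (P i); rewrite ?mul1r ?mul0r.
Qed.

Lemma sum_delta_l (I : finType) (i : I) (F : I -> C) : \sum_j (i == j)%:R * F j = F i.
Proof. by rewrite sum_indicator; under eq_bigl do rewrite eq_sym; rewrite big_pred1_eq. Qed.

Lemma sum_delta_r (I : finType) (i : I) (F : I -> C) : \sum_j F j * (j == i)%:R = F i.
Proof. by under eq_bigr do rewrite mulrC eq_sym; exact: sum_delta_l. Qed.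

Lemma mat_ext X Y (A B : mat R X Y) : A =2 B -> A = B.
Proof. by move=> AB; apply/funext => x; apply/funext => y. Qed.

Lemma mmulA X Y Z T (A : mat R X Y) (B : mat R Y Z) (D : mat R Z T) :
  A ** (B ** D) = A ** B ** D.
Proof.
apply: mat_ext => x t; rewrite /mmul.
under eq_bigr do rewrite mulr_sumr.
rewrite exchange_big /=; apply: eq_bigr => z _; rewrite mulr_suml.
by apply: eq_bigr => y _; rewrite mulrA.
Qed.

Lemma mmul1m X Y (A : mat R X Y) : @idm R X ** A = A.
Proof. by apply: mat_ext => x y; exact: sum_delta_l. Qed.

Lemma mmulm1 X Y (A : mat R X Y) : A ** @idm R Y = A.
Proof. by apply: mat_ext => x y; exact: sum_delta_r. Qed.

Lemma mmulDl X Y Z (A B : mat R X Y) (D : mat R Y Z) : (A + B) ** D = A ** D + B ** D.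
Proof.
by apply: mat_ext => x z; rewrite !fctE /mmul -big_split; apply: eq_bigr => y _; exact: mulrDl.
Qed.

Lemma mmulDr X Y Z (A B : mat R Y Z) (D : mat R X Y) : D ** (A + B) = D ** A + D ** B.
Proof.
by apply: mat_ext => x z; rewrite !fctE /mmul -big_split; apply: eq_bigr => y _; exact: mulrDr.
Qed.

Lemma mmulZl X Y Z (c : C) (A : mat R X Y) (D : mat R Y Z) : (c *: A) ** D = c *: (A ** D).
Proof.
apply: mat_ext => x z; rewrite !fctE [RHS]mulr_sumr.
by apply: eq_bigr => y _; exact/esym/mulrA.
Qed.

Lemma mmulZr X Y Z (c : C) (A : mat R X Y) (D : mat R Y Z) : A ** (c *: D) = c *: (A ** D).
Proof.
apply: mat_ext => x z; rewrite !fctE [RHS]mulr_sumr.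
by apply: eq_bigr => y _; exact: mulrCA.
Qed.

Lemma mmulBl X Y Z (A B : mat R X Y) (D : mat R Y Z) : (A - B) ** D = A ** D - B ** D.
Proof. by rewrite mmulDl -scaleN1r mmulZl scaleN1r. Qed.

Lemma mmulBr X Y Z (A B : mat R Y Z) (D : mat R X Y) : D ** (A - B) = D ** A - D ** B.
Proof. by rewrite mmulDr -scaleN1r mmulZr scaleN1r. Qed.

Lemma mmul0m X Y Z (D : mat R Y Z) : (0 : mat R X Y) ** D = 0.
Proof. by rewrite -(subrr 0) mmulBl subrr. Qed.

Lemma mmulm0 X Y Z (D : mat R X Y) : D ** (0 : mat R Y Z) = 0.
Proof. by rewrite -(subrr 0) mmulBr subrr. Qed.

Lemma adjK X Y : cancel (@adj R X Y) (@adj R Y X).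
Proof. by move=> A; apply: mat_ext => x y; exact: conjCK. Qed.

Lemma adjM X Y Z (A : mat R X Y) (B : mat R Y Z) : adj (A ** B) = adj B ** adj A.
Proof.
apply: mat_ext => z x; rewrite /adj /mmul rmorph_sum; apply: eq_bigr => y _.
by rewrite rmorphM mulrC.
Qed.

Lemma adjD X Y (A B : mat R X Y) : adj (A + B) = adj A + adj B.
Proof. by apply: mat_ext => y x; exact: rmorphD. Qed.

Lemma adjB X Y (A B : mat R X Y) : adj (A - B) = adj A - adj B.
Proof. by apply: mat_ext => y x; exact: rmorphB. Qed.

Lemma adjZ X Y (c : C) (A : mat R X Y) : adj (c *: A) = Num.conj c *: adj A.
Proof. by apply: mat_ext => y x; exact: rmorphM. Qed.

Lemma adj_idm X : adj (@idm R X) = @idm R X.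
Proof. by apply: mat_ext => x y; rewrite /adj /idm rmorph_nat eq_sym. Qed.

Lemma adj_proj X (v : vec R X) : adj (proj v) = proj v.
Proof. by apply: mat_ext => x y; rewrite /adj /proj rmorphM /= conjCK mulrC. Qed.

Lemma mtr_is_linear X : scalar (@mtr R X).
Proof. by move=> c A B; rewrite /mtr big_split /= mulr_sumr. Qed.
HB.instance Definition _ X := GRing.isLinear.Build C (mat R X X) C _ (@mtr R X) (@mtr_is_linear X).

Lemma mtrC X Y (A : mat R X Y) (B : mat R Y X) : mtr (A ** B) = mtr (B ** A).
Proof.
rewrite /mtr /mmul exchange_big; apply: eq_bigr => y _; apply: eq_bigr => x _.
exact: mulrC.
Qed.

Lemma mtr_adj X (A : mat R X X) : mtr (adj A) = Num.conj (mtr A).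
Proof. by rewrite /mtr rmorph_sum. Qed.

Lemma mtr_idm X : mtr (@idm R X) = #|X|%:R.
Proof. by rewrite /mtr /idm; under eq_bigr do rewrite eqxx; rewrite sumr_const. Qed.

Lemma unit_vecP X (v : vec R X) : unit_vec v <-> mtr (proj v) = 1.
Proof.
suff -> : mtr (proj v) = \sum_x Num.conj (v x) * v x by [].
by apply: eq_bigr => x _; exact: mulrC.
Qed.

Lemma mtr_mul_proj X (A : mat R X X) (v : vec R X) :
  mtr (A ** proj v) = \sum_x \sum_y Num.conj (v x) * A x y * v y.
Proof.
rewrite /mtr /mmul /proj; apply: eq_bigr => x _; apply: eq_bigr => y _.
by rewrite mulrA mulrC mulrA.
Qed.

Lemma proj_mapply X Y (V : mat R X Y) (v : vec R Y) :
  proj (mapply V v) = V ** proj v ** adj V.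
Proof.
apply: mat_ext => x y; rewrite /proj /mapply /mmul rmorph_sum mulr_sumr.
apply: eq_bigr => b _; rewrite !mulr_suml; apply: eq_bigr => a _.
by rewrite rmorphM /= /adj; ring.
Qed.

Lemma proj_sandwich X (A : mat R X X) (v : vec R X) :
  proj v ** A ** proj v = mtr (A ** proj v) *: proj v.
Proof.
apply: mat_ext => x y; rewrite -mmulA mtr_mul_proj !fctE /mmul /proj.
rewrite [RHS]mulr_suml; apply: eq_bigr => a _; rewrite mulr_sumr mulr_suml.
by apply: eq_bigr => b _; ring.
Qed.

Lemma proj_idem X (v : vec R X) : unit_vec v -> proj v ** proj v = proj v.
Proof.
by move=> v1; rewrite -{1}(mmulm1 (proj v)) proj_sandwich mmul1m (unit_vecP v).1 // scale1r.
Qed.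

End MatrixAlgebra.

(** * States, observables and positivity *)

Section Observables.
Variable R : realType.
Local Notation C := (R[i]).
Implicit Types X Y Z : finType.

Lemma Re_ge0 (z : C) : 0 <= z -> 0 <= Re z.
Proof. by rewrite lecE => /andP[]. Qed.

Lemma ge0_ReK (z : C) : 0 <= z -> (Re z)%:C%C = z.
Proof. by move=> z0; apply: RRe_real; exact: ger0_real. Qed.

Lemma Re_realM (c : R) (z : C) : Re (c%:C%C * z) = c * Re z.
Proof. by case: z => a b /=; rewrite mul0r subr0. Qed.

Lemma Re_conj (z : C) : Re (Num.conj z) = Re z.
Proof. by rewrite -[Num.conj z]/(conjc z); case: z. Qed.

Lemma conj_real (c : R) : Num.conj (c%:C%C : C) = c%:C%C.
Proof. exact: conjc_real. Qed.

Lemma qisometryP X Y (V : mat R X Y) : qisometry V <-> adj V ** V = @idm R Y.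
Proof. by split=> [VV|VV y y']; [exact: mat_ext|rewrite VV]. Qed.

Lemma qisometry_mul X Y Z (A : mat R X Y) (B : mat R Y Z) :
  qisometry A -> qisometry B -> qisometry (A ** B).
Proof.
move=> /qisometryP AA /qisometryP BB; apply/qisometryP.
by rewrite adjM -mmulA (mmulA (adj A)) AA mmul1m.
Qed.

Lemma qunitaryP X (U : mat R X X) :
  qunitary U <-> adj U ** U = @idm R X /\ U ** adj U = @idm R X.
Proof.
split=> [[/qisometryP UaU UUa]|[/qisometryP UaU UUa]]; split=> //; first exact: mat_ext.
by move=> x x'; rewrite UUa.
Qed.

Lemma qunitary_mul X (U U' : mat R X X) : qunitary U -> qunitary U' -> qunitary (U ** U').
Proof.
move=> /qunitaryP[UaU UUa] /qunitaryP[UaU' UUa']; apply/qunitaryP; rewrite adjM; split.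
  by rewrite -!mmulA (mmulA (adj U)) UaU mmul1m.
by rewrite -!mmulA (mmulA U') UUa' mmul1m.
Qed.

Lemma qunitary_idm X : qunitary (@idm R X).
Proof. by apply/qunitaryP; rewrite adj_idm mmul1m. Qed.

Definition reflection X (W : mat R X X) := adj W = W /\ W ** W = @idm R X.

Definition projector X (Q : mat R X X) := adj Q = Q /\ Q ** Q = Q.

Lemma reflection_idm X : reflection (@idm R X).
Proof. by split; [exact: adj_idm|exact: mmul1m]. Qed.

Lemma reflection_qunitary X (W : mat R X X) : reflection W -> qunitary W.
Proof. by case=> Wa WW; apply/qunitaryP; rewrite Wa. Qed.

Lemma reflection_conj X (U W : mat R X X) :
  qunitary U -> reflection W -> reflection (U ** W ** adj U).
Proof.
move=> /qunitaryP[UaU UUa] [Wa WW]; split; first by rewrite !adjM adjK Wa mmulA.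
by rewrite -!mmulA (mmulA (adj U)) UaU mmul1m (mmulA W) WW mmul1m.
Qed.

Lemma projector_proj X (v : vec R X) : unit_vec v -> projector (proj v).
Proof. by move=> v1; split; [exact: adj_proj|exact: proj_idem]. Qed.

Lemma projector_compl X (Q : mat R X X) : projector Q -> projector (@idm R X - Q).
Proof.
move=> [Qa QQ]; split; first by rewrite adjB adj_idm Qa.
by rewrite mmulBl !mmulBr !mmul1m mmulm1 QQ subrr subr0.
Qed.

Definition ket X (x : X) : vec R X := fun y => (y == x)%:R.

Lemma unit_vec_ket X (x : X) : unit_vec (ket x).
Proof.
by rewrite /unit_vec; under eq_bigr do rewrite /ket rmorph_nat; rewrite sum_delta_r eqxx.
Qed.

Lemma mtr_mul_proj_ket X (A : mat R X X) (x : X) : mtr (A ** proj (ket x)) = A x x.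
Proof.
rewrite mtr_mul_proj; under eq_bigr do rewrite sum_delta_r mulrC /ket rmorph_nat.
exact: sum_delta_r.
Qed.

Definition expect X (rho A : mat R X X) : R := Re (mtr (A ** rho)).

Lemma expectC X (rho A : mat R X X) : expect rho A = expect A rho.
Proof. by rewrite /expect mtrC. Qed.

Lemma expectDr X (rho A B : mat R X X) : expect rho (A + B) = expect rho A + expect rho B.
Proof. by rewrite /expect mmulDl linearD raddfD. Qed.

Lemma expectBr X (rho A B : mat R X X) : expect rho (A - B) = expect rho A - expect rho B.
Proof. by rewrite /expect mmulBl linearB raddfB. Qed.

Lemma expectZr X (rho A : mat R X X) (c : R) : expect rho (c%:C%C *: A) = c * expect rho A.
Proof. by rewrite /expect mmulZl linearZ /= Re_realM. Qed.

Lemma expectBl X (rho sigma A : mat R X X) :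
  expect (rho - sigma) A = expect rho A - expect sigma A.
Proof. by rewrite !(expectC _ A) expectBr. Qed.

Lemma expectZl X (rho A : mat R X X) (c : R) : expect (c%:C%C *: rho) A = c * expect rho A.
Proof. by rewrite !(expectC _ A) expectZr. Qed.

Lemma expect_conj X (U rho A : mat R X X) :
  expect rho (U ** A ** adj U) = expect (adj U ** rho ** U) A.
Proof. by rewrite /expect -!mmulA mtrC -!mmulA. Qed.

Lemma psdP X (A : mat R X X) : psd A <-> forall v, 0 <= mtr (A ** proj v).
Proof. by split=> A0 v; have := A0 v; rewrite mtr_mul_proj. Qed.

Lemma psd_conj X Y (A : mat R X X) (K : mat R X Y) : psd A -> psd (adj K ** A ** K).
Proof.
move=> /psdP A0; apply/psdP => v; have := A0 (mapply K v).
by rewrite proj_mapply !mmulA mtrC !mmulA.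
Qed.

Lemma psd_idm X : psd (@idm R X).
Proof.
by apply/psdP => v; rewrite mmul1m; apply: sumr_ge0 => x _; exact: mul_conjC_ge0.
Qed.

Lemma psd_gram X Y (K : mat R Y X) : psd (adj K ** K).
Proof. by have := psd_conj K (@psd_idm Y); rewrite mmulm1. Qed.

Lemma psd_proj X (v : vec R X) : psd (proj v).
Proof.
pose K : mat R unit X := fun _ x => Num.conj (v x).
have -> : proj v = adj K ** K.
  by apply: mat_ext => x y; rewrite /mmul /adj /K sumr_const card_unit conjCK.
exact: psd_gram.
Qed.

Lemma psd_diag_ge0 X (A : mat R X X) x : psd A -> 0 <= A x x.
Proof. by move=> /psdP /(_ (ket x)); rewrite mtr_mul_proj_ket. Qed.

Lemma psd_mtr_ge0 X (A : mat R X X) : psd A -> 0 <= mtr A.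
Proof. by move=> A0; apply: sumr_ge0 => x _; exact: psd_diag_ge0. Qed.

Lemma mtr_gram_eq0 X Y (K : mat R Y X) : mtr (adj K ** K) = 0 -> K = 0.
Proof.
move=> /eqP; rewrite psumr_eq0; last by move=> x _; apply: psd_diag_ge0; exact: psd_gram.
move=> /allP K0; apply: mat_ext => y x; apply/eqP; rewrite -mul_conjC_eq0 mulrC.
have := K0 x (mem_index_enum x); rewrite /= psumr_eq0; last first.
  by move=> z _; rewrite mulrC mul_conjC_ge0.
by move=> /allP /(_ y (mem_index_enum y)).
Qed.

Lemma mtr_mul_proj_eq0 X (A : mat R X X) : (forall v, mtr (A ** proj v) = 0) -> A = 0.
Proof.
move=> A0; have form x y c : A x x + c * A x y + Num.conj c * (A y x + c * A y y) = 0.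
  rewrite -[RHS](A0 (fun z => ket x z + c * ket y z)) mtr_mul_proj.
  have inner a : \sum_b Num.conj (ket x a + c * ket y a) * A a b * (ket x b + c * ket y b) =
      (A a x + c * A a y) * ket x a + Num.conj c * (A a x + c * A a y) * ket y a.
    under eq_bigr do rewrite -mulrA mulrDr; rewrite -mulr_sumr big_split /= sum_delta_r.
    under eq_bigr do rewrite mulrA.
    by rewrite sum_delta_r rmorphD rmorphM /ket !rmorph_nat; ring.
  by under eq_bigr do rewrite inner; rewrite big_split /= !sum_delta_r.
have diag0 x : A x x = 0 by have := form x x 0; rewrite rmorph0 !mul0r !addr0.
apply: mat_ext => x y; have := form x y 1; have := form x y 'i.
rewrite !diag0 conjCi rmorph1 !(mul1r, mulr0, addr0, add0r, mulNr) -mulrBr => /eqP.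
rewrite mulf_eq0 (negPf (neq0Ci _)) subr_eq0 /= => /eqP <-.
by rewrite -mulr2n => /eqP; rewrite mulrn_eq0 => /eqP.
Qed.

Lemma psd_adj X (A : mat R X X) : psd A -> adj A = A.
Proof.
move=> /psdP A0; apply/esym/eqP; rewrite -subr_eq0; apply/eqP.
apply: mtr_mul_proj_eq0 => v; rewrite mmulBl linearB /= -{2}(adj_proj v) -adjM mtr_adj.
by rewrite [in X in _ - X]mtrC (CrealP (ger0_real (A0 v))) subrr.
Qed.

Lemma expect_adj X (rho A : mat R X X) : psd rho -> expect rho (adj A) = expect rho A.
Proof. by move=> rho0; rewrite /expect -{1}(psd_adj rho0) -adjM mtr_adj Re_conj mtrC. Qed.

Lemma mtr_gram_mul_ge0 X Y (rho : mat R X X) (K : mat R Y X) :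
  psd rho -> 0 <= mtr (adj K ** K ** rho).
Proof.
by move=> rho0; rewrite -mmulA mtrC; have := psd_mtr_ge0 (psd_conj (adj K) rho0); rewrite adjK.
Qed.

Lemma expect_gram_ge0 X Y (rho : mat R X X) (K : mat R Y X) :
  psd rho -> 0 <= expect rho (adj K ** K).
Proof. by move=> rho0; exact/Re_ge0/mtr_gram_mul_ge0. Qed.

Lemma expect_cauchy_schwarz X Y (rho : mat R X X) (A B : mat R Y X) : psd rho ->
  expect rho (adj A ** B) ^+ 2 <= expect rho (adj A ** A) * expect rho (adj B ** B).
Proof.
move=> rho0; pose p := Poly [:: expect rho (adj B ** B); - 2 * expect rho (adj A ** B);
  expect rho (adj A ** A)].
have : p`_1 ^+ 2 - 4 * p`_2 * p`_0 <= 0.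
  apply: deg_le2_poly_ge0 => [|t]; first exact: size_Poly.
  have := expect_gram_ge0 (t%:C%C *: A - B) rho0; congr (_ <= _).
  have BA : expect rho (adj B ** A) = expect rho (adj A ** B).
    by rewrite -(expect_adj _ rho0) adjM adjK.
  rewrite adjB adjZ conj_real !(mmulBl, mmulBr, mmulZl, mmulZr) !(expectBr, expectZr) BA.
  by rewrite horner_Poly /=; ring.
by rewrite !coefE /=; lra.
Qed.

Corollary expect_le_sqrt X Y (rho : mat R X X) (A B : mat R Y X) : psd rho ->
  expect rho (adj A ** B) <= Num.sqrt (expect rho (adj A ** A) * expect rho (adj B ** B)).
Proof.
move=> rho0; apply: le_trans (ler_norm _) _; rewrite -sqrtr_sqr.
exact/ler_wsqrtr/expect_cauchy_schwarz.
Qed.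

Lemma expect_idm X (rho : mat R X X) : density rho -> expect rho (@idm R X) = 1.
Proof. by case=> _ rho1; rewrite /expect mmul1m rho1. Qed.

(* Splitting [T] along [1 = Q + B], the block [Q T Q] drops out and each of the others
   contains a factor [B], whose second moment is [1 - expect tau Q]. *)
Lemma expect_decoupling X (tau T Q : mat R X X) :
  density tau -> reflection T -> projector Q -> Q ** T ** Q = 0 ->
  expect tau T <= 2 * Num.sqrt (1 - expect tau Q).
Proof.
move=> tau_density [Ta TT] Q_proj QTQ; have tau0 := tau_density.1.
pose B := @idm R X - Q; have [Ba BB] : projector B := projector_compl Q_proj.
have [Qa QQ] := Q_proj.
have expB : expect tau (adj B ** B) = 1 - expect tau Q.
  by rewrite Ba BB expectBr expect_idm.
have exp_BT : expect tau (B ** T) <= Num.sqrt (1 - expect tau Q).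
  by have := expect_le_sqrt B T tau0; rewrite expB Ta TT expect_idm // mulr1 Ba.
have exp_QTB : expect tau (Q ** T ** B) <= Num.sqrt (1 - expect tau Q).
  have := expect_le_sqrt (T ** Q) B tau0; rewrite expB adjM Ta Qa => /le_trans; apply.
  rewrite ler_wsqrtr // -mmulA (mmulA T) TT mmul1m QQ; apply: ler_piMl.
    by rewrite -expB expect_gram_ge0.
  by rewrite -subr_ge0 -expB expect_gram_ge0.
have -> : T = B ** T + Q ** T ** B.
  by rewrite mmulBl mmul1m mmulBr mmulm1 QTQ subr0 subrK.
by rewrite expectDr; lra.
Qed.

End Observables.

(** * Square roots, trace norm and fidelity *)

Section TraceNorm.
Variable R : realType.
Local Notation C := (R[i]).
Implicit Types X Y : finType.

Definition pullback X Y (f : X -> Y) (A : mat R Y Y) : mat R X X := fun x x' => A (f x) (f x').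

Lemma pullback_mul X Y (f : X -> Y) (A B : mat R Y Y) :
  bijective f -> pullback f (A ** B) = pullback f A ** pullback f B.
Proof. by move=> f_bij; apply: mat_ext => x x'; apply: reindex; exact: onW_bij. Qed.

Lemma pullback_adj X Y (f : X -> Y) (A : mat R Y Y) : pullback f (adj A) = adj (pullback f A).
Proof. by []. Qed.

Lemma pullback_idm X Y (f : X -> Y) : injective f -> pullback f (@idm R Y) = @idm R X.
Proof. by move=> f_inj; apply: mat_ext => x x'; rewrite /pullback /idm (inj_eq f_inj). Qed.

Lemma mtr_pullback X Y (f : X -> Y) (A : mat R Y Y) : bijective f -> mtr (pullback f A) = mtr A.
Proof. by move=> f_bij; apply/esym/reindex; exact: onW_bij. Qed.

Lemma psd_pullback X Y (f : X -> Y) (A : mat R Y Y) : psd A -> psd (pullback f A).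
Proof.
pose K : mat R Y X := fun y x => (y == f x)%:R.
have -> : pullback f A = adj K ** A ** K.
  apply: mat_ext => x x'; rewrite {1}/mmul sum_delta_r /mmul /adj /K.
  by under eq_bigr do rewrite rmorph_nat eq_sym; rewrite sum_delta_l.
exact: psd_conj.
Qed.

Definition diagm X (p : X -> R) : mat R X X := fun x y => (p x)%:C%C * (x == y)%:R.

Lemma diagm_mul X (p q : X -> R) : diagm p ** diagm q = diagm (fun x => p x * q x).
Proof.
apply: mat_ext => x y; rewrite /mmul /diagm; under eq_bigr do rewrite -mulrA.
by rewrite -mulr_sumr sum_delta_l mulrA rmorphM.
Qed.

Lemma adj_diagm X (p : X -> R) : adj (diagm p) = diagm p.
Proof.
apply: mat_ext => x y; rewrite /adj /diagm rmorphM /= conj_real rmorph_nat eq_sym.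
by case: eqP => [->|]; rewrite ?mulr0.
Qed.

Lemma Re_mtr_diagm X (p : X -> R) : Re (mtr (diagm p)) = \sum_x p x.
Proof. by rewrite raddf_sum; apply: eq_bigr => x _; rewrite /diagm eqxx mulr1. Qed.

Definition mat_of_mx X (N : 'M[C]_#|X|) : mat R X X := pullback enum_rank N.

Lemma mat_of_mxM X (N N' : 'M[C]_#|X|) : mat_of_mx (N *m N') = mat_of_mx N ** mat_of_mx N'.
Proof.
rewrite -pullback_mul; last exact: enum_rank_bij.
by apply: mat_ext => x y; rewrite /mat_of_mx /pullback mxE.
Qed.

Lemma mat_of_mx1 X : mat_of_mx 1%:M = @idm R X.
Proof. by apply: mat_ext => x y; rewrite /mat_of_mx /pullback mxE (inj_eq enum_rank_inj). Qed.

Lemma mat_of_mx_adj X (N : 'M[C]_#|X|) : mat_of_mx (map_mx Num.conj N^T) = adj (mat_of_mx N).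
Proof. by apply: mat_ext => x y; rewrite /mat_of_mx /pullback !mxE. Qed.

Lemma psd_spectral X (A : mat R X X) : psd A ->
  exists (E : mat R X X) (p : X -> R),
    [/\ qunitary E, forall x, 0 <= p x & A = E ** diagm p ** adj E].
Proof.
move=> A0; pose M : 'M[C]_#|X| := \matrix_(i, j) A (enum_val i) (enum_val j).
have AM : A = mat_of_mx M.
  by apply: mat_ext => x y; rewrite /mat_of_mx /pullback mxE !enum_rankK.
have M_herm : M \is hermsymmx.
  apply/is_hermitianmxP; rewrite expr0 scale1r; apply/matrixP => i j; rewrite !mxE.
  by rewrite -[in LHS](psd_adj A0).
have P_unitary := spectral_unitarymx M.
have := orthomx_spectralP (hermitian_normalmx M_herm); rewrite (invmx_unitary P_unitary) => M_spec.
pose E := adj (mat_of_mx (spectralmx M)); pose D := mat_of_mx (diag_mx (spectral_diag M)).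
have E_unitary : qunitary E.
  apply/qunitaryP; rewrite /E adjK -mat_of_mx_adj -!mat_of_mxM (unitarymxP P_unitary).
  by rewrite -(invmx_unitary P_unitary) mulVmx ?mat_of_mx1 // unitarymx_unit.
have [EaE _] := (qunitaryP E).1 E_unitary.
have AD : A = E ** D ** adj E by rewrite AM [in LHS]M_spec !mat_of_mxM mat_of_mx_adj /E adjK.
have D0 x : 0 <= D x x.
  have -> : D = adj E ** A ** E by rewrite AD !mmulA EaE mmul1m -mmulA EaE mmulm1.
  exact/psd_diag_ge0/psd_conj.
exists E, (fun x => Re (D x x)); split=> // [x|]; first exact: Re_ge0.
rewrite [LHS]AD; congr (_ ** _ ** _); apply: mat_ext => x y.
rewrite /diagm ge0_ReK // /D /mat_of_mx /pullback !mxE (inj_eq enum_rank_inj) eqxx.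
by case: eqP => _; rewrite ?mulr1 ?mulr0.
Qed.

Lemma msqrtP X (A : mat R X X) : psd A -> psd (msqrt A) /\ msqrt A ** msqrt A = A.
Proof.
move=> A0; have [E [p [/qunitaryP[EaE _] p0 AE]]] := psd_spectral A0.
pose D := diagm (fun x => Num.sqrt (p x)).
have conj_diag q : E ** diagm q ** adj E ** (E ** diagm q ** adj E) =
    E ** diagm (fun x => q x * q x) ** adj E.
  by rewrite -!mmulA (mmulA (adj E)) EaE mmul1m (mmulA (diagm q)) diagm_mul.
have [|P0 PP] := @epsilon_spec _ (inhabits (fun _ _ => 0 : C))
    (fun P : mat R X X => psd P /\ P ** P =2 A); last by split=> //; exact: mat_ext.
exists (E ** D ** adj E); split.
  have -> : E ** D ** adj E = adj (diagm (fun x => Num.sqrt (Num.sqrt (p x))) ** adj E) **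
      (diagm (fun x => Num.sqrt (Num.sqrt (p x))) ** adj E).
    rewrite adjM adjK adj_diagm [RHS]mmulA -[in RHS](mmulA E) diagm_mul; congr (_ ** diagm _ ** _).
    by apply/funext => x; rewrite -expr2 sqr_sqrtr ?sqrtr_ge0.
  exact: psd_gram.
move=> x y; rewrite conj_diag AE; congr ((_ ** diagm _ ** _) _ _).
by apply/funext => z; rewrite -expr2 sqr_sqrtr.
Qed.

Lemma psd_is_gram X (A : mat R X X) : psd A -> exists K : mat R X X, A = adj K ** K.
Proof.
by move=> /msqrtP[S0 SS]; exists (msqrt A); rewrite psd_adj.
Qed.

(* With [D = P - Q] and [P ** P = Q ** Q] one has [D P = - Q D], so the traces of the
   positive operators [D P D] and [D Q D] are opposite, hence both vanish. *)
Lemma psd_sqr_inj X (P Q : mat R X X) : psd P -> psd Q -> P ** P = Q ** Q -> P = Q.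
Proof.
move=> P0 Q0 PQ; pose D := P - Q.
have Da : adj D = D by rewrite adjB !psd_adj.
have tr_opp : mtr (D ** P ** D) + mtr (D ** Q ** D) = 0.
  have -> : D ** P = - (Q ** D) by rewrite mmulBl mmulBr PQ opprB.
  by rewrite -(mmulA D Q) [X in _ + X]mtrC -linearD /= -mmulDl addNr mmul0m linear0.
have DAD0 A : psd A -> 0 <= mtr (D ** A ** D).
  by move=> A0; have := psd_mtr_ge0 (psd_conj D A0); rewrite Da.
have vanish A : psd A -> mtr (D ** A ** D) = 0 -> A ** D = 0.
  move=> /psd_is_gram[K ->]; rewrite !mmulA -mmulA -{1}Da -adjM => /mtr_gram_eq0 KD.
  by rewrite -mmulA KD mmulm0.
move/eqP: tr_opp; rewrite paddr_eq0 ?DAD0 // => /andP[/eqP/(vanish _ P0) PD /eqP/(vanish _ Q0) QD].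
apply/eqP; rewrite -subr_eq0 -/D; apply/eqP/mtr_gram_eq0.
by rewrite Da {1}/D mmulBl PD QD subrr linear0.
Qed.

Lemma msqrt_eq X (A P : mat R X X) : psd P -> P ** P = A -> msqrt A = P.
Proof.
move=> P0 PP; have A0 : psd A by rewrite -PP -{1}(psd_adj P0); exact: psd_gram.
have [S0 SS] := msqrtP A0; apply: psd_sqr_inj => //; by rewrite SS.
Qed.

Lemma trnorm_eq X Y (A : mat R X Y) (P : mat R Y Y) :
  psd P -> P ** P = adj A ** A -> trnorm A = Re (mtr P).
Proof. by move=> P0 PP; rewrite /trnorm (msqrt_eq P0 PP). Qed.

Lemma trnorm_ge0 X Y (A : mat R X Y) : 0 <= trnorm A.
Proof. by apply/Re_ge0/psd_mtr_ge0; case: (msqrtP (psd_gram A)). Qed.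

Lemma expect_ket X (x : X) (A : mat R X X) : expect (proj (ket R x)) A = Re (A x x).
Proof. by rewrite /expect mtr_mul_proj_ket. Qed.

Lemma expect_le_trnorm X (W A : mat R X X) : qunitary W -> expect A W <= trnorm A.
Proof.
move=> /qunitaryP[_ WWa]; have [P0 PP] := msqrtP (psd_gram A); rewrite (trnorm_eq P0 PP).
move: (msqrt _) P0 PP => P P0 PP; have [E [p [/qunitaryP[EaE EEa] p0 PE]]] := psd_spectral P0.
pose U := adj W ** E; pose B := A ** E.
have -> : expect A W = Re (mtr (adj U ** B)).
  by rewrite /expect [in LHS]mtrC adjM adjK [in RHS]mtrC -mmulA (mmulA E) EEa mmul1m.
have -> : Re (mtr P) = \sum_x p x.
  by rewrite PE -mmulA mtrC -mmulA EaE mmulm1 Re_mtr_diagm.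
have UU : adj U ** U = @idm R X by rewrite adjM adjK -mmulA (mmulA W) WWa mmul1m.
have BB : adj B ** B = diagm (fun x => p x ^+ 2).
  rewrite adjM -mmulA (mmulA (adj A)) -PP PE -!mmulA EaE mmulm1 (mmulA (adj E)) EaE mmul1m.
  by rewrite (mmulA (adj E)) EaE mmul1m diagm_mul.
rewrite raddf_sum; apply: ler_sum => x _.
have := expect_le_sqrt U B (psd_proj (ket R x)).
by rewrite !expect_ket UU BB /idm /diagm !eqxx mulr1 mul1r /= sqrtr_sqr (ger0_norm (p0 x)).
Qed.

(* [|A|_xx <= 1 + |A|_xx ^ 2 <= 1 + (A^* A)_xx] *)
Lemma trnorm_le_entries X (A : mat R X X) (K : R) :
  (forall x y, `|A x y| <= K%:C%C) -> trnorm A <= #|X|%:R * (1 + #|X|%:R * K ^+ 2).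
Proof.
move=> AK; have [P0 PP] := msqrtP (psd_gram A); rewrite (trnorm_eq P0 PP).
move: (msqrt _) P0 PP => P P0 PP.
rewrite raddf_sum mulr_natl -sumr_const; apply: ler_sum => x _ /=.
have lower : (Re (P x x)) ^+ 2 <= Re ((P ** P) x x).
  have := expect_cauchy_schwarz (@idm R X) P (psd_proj (ket R x)).
  by rewrite !expect_ket adj_idm (psd_adj P0) !mmul1m /idm eqxx mul1r.
have upper : Re ((P ** P) x x) <= #|X|%:R * K ^+ 2.
  rewrite PP /mmul raddf_sum mulr_natl -sumr_const; apply: ler_sum => y _.
  have : `|A y x| ^+ 2 <= (K ^+ 2)%:C%C.
    by rewrite rmorphXn lerXn2r ?nnegrE // (le_trans _ (AK y x)).
  by rewrite lecE /adj -normCKC => /andP[].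
by have := sqr_ge0 (Re (P x x) - 1); nra.
Qed.

Lemma fid_ge0 X (rho sigma : mat R X X) : 0 <= fid rho sigma.
Proof. exact: trnorm_ge0. Qed.

Lemma fid_proj X (rho : mat R X X) (v : vec R X) :
  psd rho -> unit_vec v -> fid rho (proj v) = Num.sqrt (expect rho (proj v)).
Proof.
move=> rho0 v1; have [r0 rr] := msqrtP rho0; have vv := proj_idem v1.
have fid0 : 0 <= expect rho (proj v).
  by rewrite -vv -{1}(adj_proj v); exact: expect_gram_ge0.
rewrite /fid (msqrt_eq (psd_proj v) vv); set c := Num.sqrt _.
have c0 : 0 <= c%:C%C :> C by rewrite ler0c sqrtr_ge0.
rewrite (@trnorm_eq _ _ _ (c%:C%C *: proj v)).
- by rewrite linearZ /= (unit_vecP v).1 // Re_realM mulr1.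
- apply/psdP => w; rewrite mmulZl linearZ; apply: mulr_ge0 => //.
  exact: (psdP _).1 (psd_proj v) w.
rewrite mmulZl mmulZr scalerA -rmorphM /= -expr2 sqr_sqrtr // vv.
rewrite adjM adj_proj (psd_adj r0) -mmulA (mmulA (msqrt rho)) rr mmulA proj_sandwich.
by rewrite expectC /expect ge0_ReK //; exact: (psdP _).1.
Qed.

End TraceNorm.

(** * Operators supported on a set of qubits *)

Section Support.
Variables (R : realType) (n : nat).
Implicit Types (S T : {set 'I_n}) (x y : qb n).

Definition eq_off S x y := [forall i, (i \notin S) ==> (x i == y i)].

Lemma eq_offP S x y : reflect (forall i, i \notin S -> x i = y i) (eq_off S x y).
Proof.
apply: (iffP forallP) => xy i; first by move/(implyP (xy i))/eqP.
by apply/implyP => /xy ->.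
Qed.

Lemma eq_off_refl S x : eq_off S x x. Proof. exact/eq_offP. Qed.

Lemma eq_off_sym S x y : eq_off S x y = eq_off S y x.
Proof. by apply/eq_offP/eq_offP => xy i /xy. Qed.

Lemma restr_eqP S x y : reflect {in S, x =1 y} (restr S x == restr S y).
Proof.
apply: (iffP eqP) => [xy i iS|xy]; last by apply/ffunP => -[i iS]; rewrite !ffunE xy.
by have /ffunP/(_ (exist _ i iS)) := xy; rewrite !ffunE.
Qed.

Lemma qb_eqE S x y : (x == y) = (restr S x == restr S y) && eq_off S x y.
Proof.
apply/eqP/andP => [->|[/restr_eqP xyS /eq_offP xyN]]; first by rewrite eq_off_refl.
by apply/ffunP => i; case: (boolP (i \in S)) => [/xyS|/xyN].
Qed.

Lemma eq_off_setC S x y : eq_off (~: S)%SET x y = (restr S x == restr S y).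
Proof.
by apply/eq_offP/restr_eqP => xy i; [move=> iS; apply: xy|]; rewrite inE negbK => // /xy.
Qed.

Lemma restr_setC_eq S x y : (restr (~: S)%SET x == restr (~: S)%SET y) = eq_off S x y.
Proof. by rewrite -eq_off_setC finset.setCK. Qed.

Definition glue S (r : subq S) x : qb n := [ffun i => if insub i is Some j then r j else x i].

Lemma glue_in S (r : subq S) x i (iS : i \in S) : glue r x i = r (exist _ i iS).
Proof. by rewrite ffunE insubT. Qed.

Lemma glue_restr_in S x y : {in S, glue (restr S x) y =1 x}.
Proof. by move=> i iS; rewrite glue_in ffunE. Qed.

Lemma glue_notin S (r : subq S) x i : i \notin S -> glue r x i = x i.
Proof. by move=> iS; rewrite ffunE insubN. Qed.

Lemma restr_glue S (r : subq S) x : restr S (glue r x) = r.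
Proof. by apply/ffunP => -[i iS]; rewrite ffunE glue_in. Qed.

Lemma eq_off_glue S (r : subq S) x y : eq_off S (glue r x) y = eq_off S x y.
Proof. by apply/eq_offP/eq_offP => xy i iS; move: (xy i iS); rewrite glue_notin. Qed.

Lemma glue_eq S (r : subq S) x y : (glue r x == y) = (r == restr S y) && eq_off S x y.
Proof. by rewrite (qb_eqE S) restr_glue eq_off_glue. Qed.

Lemma glue_restr S x y : eq_off S x y -> glue (restr S x) y = x.
Proof. by move=> xy; apply/eqP; rewrite glue_eq eqxx eq_off_sym. Qed.

Lemma glue_glue S (r s : subq S) x : glue r (glue s x) = glue r x.
Proof.
apply/eqP; rewrite glue_eq restr_glue eqxx.
by rewrite eq_off_glue eq_off_sym eq_off_glue eq_off_refl.
Qed.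

Lemma sum_eq_off (A : nmodType) S y (F : qb n -> A) :
  \sum_(x | eq_off S x y) F x = \sum_(r : subq S) F (glue r y).
Proof.
rewrite (reindex (fun r : subq S => glue r y)) /=.
  by apply: eq_bigl => r; rewrite eq_off_glue eq_off_refl.
by exists (restr S) => [r _|x]; [exact: restr_glue|rewrite inE => /glue_restr].
Qed.

Lemma sum_restr (A : nmodType) S (s : subq S) (F : qb n -> A) :
  \sum_x F x = \sum_(x | restr S x == s) \sum_(r : subq S) F (glue r x).
Proof.
rewrite (partition_big (glue s) (fun x => restr S x == s)) => [|x _]; last by rewrite restr_glue.
apply: eq_bigr => x /eqP xs; rewrite -sum_eq_off; apply: eq_bigl => y.
by rewrite glue_eq xs eqxx.
Qed.

Definition embed S (a : mat R (subq S) (subq S)) : mat R (qb n) (qb n) :=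
  fun x y => (eq_off S x y)%:R * a (restr S x) (restr S y).

Lemma embed_mulE S (a : mat R (subq S) (subq S)) (Z : finType) (B : mat R (qb n) Z) x z :
  (embed a ** B) x z = \sum_r a (restr S x) r * B (glue r x) z.
Proof.
rewrite /mmul /embed; under eq_bigr do rewrite -mulrA eq_off_sym.
by rewrite sum_indicator sum_eq_off; apply: eq_bigr => r _; rewrite restr_glue.
Qed.

Lemma embed_mul S (a b : mat R (subq S) (subq S)) : embed (a ** b) = embed a ** embed b.
Proof.
apply: mat_ext => x y; rewrite embed_mulE [LHS]mulr_sumr; apply: eq_bigr => r _.
by rewrite /embed restr_glue eq_off_glue mulrCA.
Qed.

Lemma embed_idm S : embed (@idm R (subq S)) = @idm R (qb n).
Proof. by apply: mat_ext => x y; rewrite /embed /idm -natrM mulnb andbC -qb_eqE. Qed.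

Lemma embed_adj S (a : mat R (subq S) (subq S)) : embed (adj a) = adj (embed a).
Proof. by apply: mat_ext => x y; rewrite /embed /adj rmorphM /= rmorph_nat eq_off_sym. Qed.

Lemma embed_inj S : injective (@embed S).
Proof.
move=> a b ab; apply: mat_ext => r s; pose z : qb n := [ffun=> false].
have := congr1 (fun A : mat R (qb n) (qb n) => A (glue r z) (glue s z)) ab.
by rewrite /embed !restr_glue eq_off_glue eq_off_sym eq_off_glue eq_off_refl !mul1r.
Qed.

Lemma qunitary_embed S (a : mat R (subq S) (subq S)) : qunitary a -> qunitary (embed a).
Proof.
move=> /qunitaryP[a1 a2]; apply/qunitaryP.
by rewrite -embed_adj -!embed_mul a1 a2 embed_idm.
Qed.

Lemma reflection_embed S (a : mat R (subq S) (subq S)) : reflection (embed a) -> reflection a.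
Proof.
move=> [Aa AA]; split; apply: embed_inj; first by rewrite embed_adj.
by rewrite embed_mul embed_idm.
Qed.

Lemma ptrE S (rho : mat R (qb n) (qb n)) (r s : subq S) :
  ptr rho r s = \sum_(y | restr S y == s) rho (glue r y) y.
Proof.
rewrite /ptr exchange_big [RHS]big_mkcond; apply: eq_bigr => y _ /=.
under eq_bigr do rewrite -/(eq_off _ _ _) andbCA [_ == r]eq_sym [eq_off _ _ y]eq_off_sym -glue_eq.
by case: eqP => _ /=; [exact: sum_delta_l|apply: big1 => x _; rewrite mul0r].
Qed.

Lemma ptrB S (A B : mat R (qb n) (qb n)) : ptr (S := S) (A - B) = ptr A - ptr B.
Proof. by apply: mat_ext => r s; rewrite !fctE !ptrE -sumrB; apply: eq_bigr. Qed.

Lemma mtr_embed_mul S (a : mat R (subq S) (subq S)) (rho : mat R (qb n) (qb n)) :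
  mtr (embed a ** rho) = mtr (a ** ptr rho).
Proof.
rewrite /mtr; under eq_bigr do rewrite embed_mulE.
rewrite (partition_big (restr S) xpredT) //; apply: eq_bigr => s _.
rewrite exchange_big; apply: eq_bigr => r _; rewrite ptrE mulr_sumr.
by apply: eq_bigr => y /eqP ->.
Qed.

Lemma ptr_setC S (rho : mat R (qb n) (qb n)) x y :
  ptr rho (restr (~: S)%SET x) (restr (~: S)%SET y) = \sum_(r : subq S) rho (glue r x) (glue r y).
Proof.
rewrite ptrE; under eq_bigl do rewrite restr_setC_eq; rewrite sum_eq_off.
apply: eq_bigr => r _; congr (rho _ _); apply/eqP.
rewrite glue_eq restr_setC_eq eq_off_setC !restr_glue eqxx andbT.
by rewrite eq_off_sym eq_off_glue eq_off_refl.
Qed.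

Lemma expect_ptr S (a : mat R (subq S) (subq S)) (rho : mat R (qb n) (qb n)) :
  expect rho (embed a) = expect (ptr rho) a.
Proof. by rewrite /expect mtr_embed_mul. Qed.

Definition supported S (A : mat R (qb n) (qb n)) := exists a, A = embed (S := S) a.

Lemma supported_mul S A B : supported S A -> supported S B -> supported S (A ** B).
Proof. by move=> [a ->] [b ->]; exists (a ** b); rewrite embed_mul. Qed.

Lemma supported_adj S A : supported S A -> supported S (adj A).
Proof. by move=> [a ->]; exists (adj a); rewrite embed_adj. Qed.

Lemma supported_idm S : supported S (@idm R (qb n)).
Proof. by exists (@idm R (subq S)); rewrite embed_idm. Qed.

Lemma supported_sub S T A : S \subset T -> supported S A -> supported T A.
Proof.
move=> /fintype.subsetP ST [a ->]; pose z : qb n := [ffun=> false].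
exists (fun r s => embed a (glue r z) (glue s z)); apply: mat_ext => x y.
have restrST u : restr S (glue (restr T u) z) = restr S u.
  by apply/eqP/restr_eqP => i /ST iT; rewrite glue_restr_in.
rewrite /embed !restrST mulrA -natrM mulnb; congr ((nat_of_bool _)%:R * _).
apply/eq_offP/andP => [xy|[/eq_offP xyT /eq_offP xyS] i iS].
  split; apply/eq_offP => i iN; first by apply: xy; apply: contra iN; exact: ST.
  by case: (boolP (i \in T)) => iT; [rewrite !glue_restr_in // xy|rewrite !glue_notin].
by case: (boolP (i \in T)) => [iT|/xyT //]; have := xyS i iS; rewrite !glue_restr_in.
Qed.

Lemma eq_off_glue_disjoint S T (r : subq S) x y : [disjoint S & T] ->
  eq_off T (glue r x) y = (r == restr S y) && eq_off (S :|: T)%SET x y.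
Proof.
move=> ST; apply/eq_offP/andP => [xy|[/eqP -> /eq_offP xy] i iT]; last first.
  case: (boolP (i \in S)) => iS; first by rewrite glue_restr_in.
  by rewrite glue_notin // xy // finset.inE negb_or iS.
split.
  apply/eqP/ffunP => -[i iS]; rewrite ffunE -xy; first by rewrite glue_in.
  by rewrite (disjointFr ST).
by apply/eq_offP => i; rewrite finset.inE negb_or => /andP[iS iT]; rewrite -xy // glue_notin.
Qed.

Lemma restr_glue_disjoint S T (r : subq S) x : [disjoint S & T] -> restr T (glue r x) = restr T x.
Proof. by move=> ST; apply/eqP/restr_eqP => i iT; rewrite glue_notin // (disjointFl ST). Qed.

Lemma embed_mul_disjoint S T (a : mat R (subq S) (subq S)) (b : mat R (subq T) (subq T)) x y :
  [disjoint S & T] ->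
  (embed a ** embed b) x y = (eq_off (S :|: T)%SET x y)%:R *
    (a (restr S x) (restr S y) * b (restr T x) (restr T y)).
Proof.
move=> ST; rewrite embed_mulE (bigD1 (restr S y)) //= big1 ?addr0 => [|r /negPf ry].
  by rewrite /embed eq_off_glue_disjoint // eqxx restr_glue_disjoint // mulrCA.
by rewrite /embed eq_off_glue_disjoint // ry mul0r mulr0.
Qed.

Lemma supported_comm S T A B :
  supported S A -> supported T B -> [disjoint S & T] -> A ** B = B ** A.
Proof.
move=> [a ->] [b ->] ST; apply: mat_ext => x y.
rewrite !embed_mul_disjoint // 1?disjoint_sym // finset.setUC; congr (_ * _); exact: mulrC.
Qed.

End Support.

(** * Light cones of circuits *)

Section LightCones.
Variables (R : realType) (n : nat).
Local Notation pair_of_qubits := ('I_n * 'I_n)%type.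
Local Notation bit2 := (bool * bool)%type.
Implicit Types (p : pair_of_qubits) (P : {set pair_of_qubits}) (S : {set 'I_n}).
Implicit Types (i : 'I_n) (x y : qb n).

Definition pair_set p : {set 'I_n} := [set p.1; p.2]%SET.

Definition pair_val p (r : subq (pair_set p)) : bit2 :=
  (r (exist _ p.1 (set21 p.1 p.2)), r (exist _ p.2 (set22 p.1 p.2))).

Lemma pair_val_restr p x : pair_val (restr (pair_set p) x) = (x p.1, x p.2).
Proof. by rewrite /pair_val !ffunE. Qed.

Lemma pair_val_bij p : p.1 != p.2 -> bijective (@pair_val p).
Proof.
move=> p12; exists (fun b => restr (pair_set p) [ffun i => if i == p.1 then b.1 else b.2]).
  move=> r; apply/ffunP => -[i ip]; rewrite !ffunE /=.
  case: eqP => [ip1|ip1]; congr (r _); apply: val_inj => //=.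
  by move: ip; rewrite !inE => /orP[]/eqP.
by move=> [b1 b2]; rewrite pair_val_restr !ffunE eqxx eq_sym (negPf p12).
Qed.

Definition gate p (G : mat R bit2 bit2) : mat R (qb n) (qb n) := embed (pullback (@pair_val p) G).

Lemma supported_gate p G : supported (pair_set p) (gate p G).
Proof. by eexists. Qed.

Lemma qunitary_gate p G : p.1 != p.2 -> qunitary G -> qunitary (gate p G).
Proof.
move=> /pair_val_bij pv_bij /qunitaryP[G1 G2]; apply/qunitary_embed/qunitaryP.
by rewrite -pullback_adj -!pullback_mul // G1 G2 pullback_idm //; exact: bij_inj.
Qed.

Lemma pair_set_disjoint P p p' :
  valid_pairs P -> p \in P -> p' \in P -> p != p' -> [disjoint pair_set p & pair_set p'].
Proof.
move=> [_ dis] pP p'P /(dis p p' pP p'P)/and4P[e11 e12 e21 e22].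
rewrite disjoint_subset; apply/fintype.subsetP => i.
by rewrite !inE negb_or => /orP[]/eqP ->; apply/andP.
Qed.

Definition qubits P : {set 'I_n} := \bigcup_(p in P) pair_set p.

Lemma coveredE P i : covered P i = (i \in qubits P).
Proof.
by apply/exists_inP/bigcupP => -[p pP ip]; exists p => //; move: ip; rewrite !inE ![i == _]eq_sym.
Qed.

Lemma layer_opE P (U : pair_of_qubits -> mat R bit2 bit2) x y : layer_op P U x y =
  (\prod_(p in P) U p (x p.1, x p.2) (y p.1, y p.2)) * (eq_off (qubits P) x y)%:R.
Proof.
by rewrite /layer_op; congr (_ * (nat_of_bool _)%:R); apply: eq_forallb => i; rewrite coveredE.
Qed.

Lemma layer_op0 U : layer_op finset.set0 U = @idm R (qb n).
Proof.
apply: mat_ext => x y; rewrite layer_opE /qubits !big_set0 mul1r /idm.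
have -> : (x == y) = eq_off finset.set0 x y; last by [].
by rewrite (qb_eqE finset.set0) andb_idl // => _; apply/restr_eqP => i; rewrite inE.
Qed.

Lemma layer_opU1 P p (U : pair_of_qubits -> mat R bit2 bit2) :
  p \notin P -> [disjoint pair_set p & qubits P] ->
  layer_op (p |: P)%SET U = gate p (U p) ** layer_op P U.
Proof.
move=> pP dis; apply: mat_ext => x y.
have glue_off (r : subq (pair_set p)) q i : q \in P -> i \in pair_set q -> glue r x i = x i.
  move=> qP iq; apply: glue_notin; apply/negbT/(disjointFl dis)/bigcupP.
  by exists q.
rewrite embed_mulE (bigD1 (restr (pair_set p) y)) //= big1 ?addr0 => [|r /negPf ry]; last first.
  by rewrite layer_opE eq_off_glue_disjoint // ry !mulr0.
rewrite !layer_opE eq_off_glue_disjoint // eqxx /pullback !pair_val_restr.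
rewrite /qubits !big_setU1 //= mulrA; congr (_ * _ * _).
by apply: eq_bigr => q qP; rewrite !(glue_off _ q) // ?set21 ?set22.
Qed.

Lemma layer_op_ind (K : mat R (qb n) (qb n) -> Prop) P (U : pair_of_qubits -> mat R bit2 bit2) :
  valid_pairs P -> K (@idm R (qb n)) ->
  (forall p L, p \in P -> K L -> K (gate p (U p) ** L)) -> K (layer_op P U).
Proof.
move=> valid K1 Kgate; have [m] := ubnP #|P|.
suff sub (Q : {set pair_of_qubits}) : Q \subset P -> (#|Q| < m)%N -> K (layer_op Q U) by exact: sub.
elim: m Q => // m IH Q QP; have [->|[p pQ]] := set_0Vmem Q; first by rewrite layer_op0.
have QPp : (Q :\ p)%SET \subset P := fintype.subset_trans (subD1set Q p) QP.
have pP := fintype.subsetP QP _ pQ.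
rewrite (cardsD1 p) pQ ltnS => Qm; rewrite -(finset.setD1K pQ) layer_opU1 ?setD11 //.
  by apply: Kgate => //; exact: IH.
rewrite disjoint_sym disjoint_subset; apply/fintype.subsetP => i /bigcupP[q].
rewrite in_setD1 => /andP[qp qQ] iq; have qP := fintype.subsetP QP _ qQ.
by have := disjointFr (pair_set_disjoint valid qP pP qp) iq; rewrite !inE => ->.
Qed.

Definition block P i : {set 'I_n} :=
  if [pick p in P | i \in pair_set p] is Some p then pair_set p else [set i].

Lemma mem_block P i : i \in block P i.
Proof. by rewrite /block; case: pickP => [p /andP[]|_] //; rewrite inE. Qed.

Lemma card_block P i : (#|block P i| <= 2)%N.
Proof. by rewrite /block; case: pickP => [p _|_]; rewrite ?cards2 ?cards1 //; case: (_ == _). Qed.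

Lemma block_pair_set P p i : valid_pairs P -> p \in P -> i \in pair_set p -> block P i = pair_set p.
Proof.
move=> valid pP ip; rewrite /block; case: pickP => [q /andP[qP iq]|/(_ p)]; last by rewrite pP ip.
have [->//|qp] := eqVneq q p.
by have := disjointFr (pair_set_disjoint valid qP pP qp) iq; rewrite ip.
Qed.

Lemma block_eq P i j : valid_pairs P -> j \in block P i -> block P j = block P i.
Proof.
move=> valid; rewrite {1 3}/block; case: pickP => [p /andP[pP _]|no_pair].
  exact: block_pair_set.
by rewrite inE => /eqP ->; rewrite /block; case: pickP => // p; rewrite no_pair.
Qed.

Definition cone P S : {set 'I_n} := \bigcup_(i in S) block P i.

Lemma sub_cone P S : S \subset cone P S.
Proof. by apply/fintype.subsetP => i iS; apply/bigcupP; exists i => //; exact: mem_block. Qed.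

Lemma card_cone P S : (#|cone P S| <= 2 * #|S|)%N.
Proof.
rewrite mulnC -sum_nat_const.
apply: (big_ind2 (fun (T : {set 'I_n}) m => #|T| <= m)%N) => [|T m T' m' Tm T'm'|i _].
- by rewrite cards0.
- exact: leq_trans (leq_card_setU T T') (leq_add Tm T'm').
- exact: card_block.
Qed.

Lemma pair_set_cone P p S : valid_pairs P -> p \in P ->
  pair_set p \subset cone P S \/ [disjoint pair_set p & cone P S].
Proof.
move=> valid pP; case: (boolP [disjoint _ & _]) => [|]; first by right.
move=> /pred0Pn[j /andP[jp /bigcupP[i iS ji]]]; left.
rewrite -(block_pair_set valid pP jp) (block_eq valid ji); exact: finset.bigcup_sup.
Qed.

Definition circuit_op (c : seq (mat R (qb n) (qb n))) : mat R (qb n) (qb n) :=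
  foldr (@mmul R _ _ _) (@idm R (qb n)) c.

Lemma run_circuit_op c : run c = mapply (circuit_op c) (@zero_state R n).
Proof.
elim: c => [|L c IH] /=; apply/funext => x; rewrite /mapply; first by rewrite sum_delta_l.
rewrite -/(run c) IH /mapply /mmul; under eq_bigr do rewrite mulr_sumr.
rewrite exchange_big; apply: eq_bigr => y _; rewrite mulr_suml.
by apply: eq_bigr => z _; rewrite mulrA.
Qed.

Definition light_cone_bound (m : nat) (U : mat R (qb n) (qb n)) :=
  qunitary U /\ forall S A, supported S A ->
    exists2 S' : {set 'I_n}, (#|S'| <= m * #|S|)%N & supported S' (U ** A ** adj U).

Lemma light_cone_bound_idm : light_cone_bound 1 (@idm R (qb n)).
Proof.
split=> [|S A sA]; first exact: qunitary_idm.
by exists S; rewrite ?mul1n // adj_idm mmul1m mmulm1.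
Qed.

Lemma light_cone_bound_mul m m' U U' :
  light_cone_bound m U -> light_cone_bound m' U' -> light_cone_bound (m * m') (U ** U').
Proof.
move=> [unitaryU coneU] [unitaryU' coneU']; split=> [|S A]; first exact: qunitary_mul.
move=> /coneU'[S' S'S] /coneU[S'' S''S' sUA]; exists S''.
  by rewrite -mulnA (leq_trans S''S') // leq_mul2l S'S orbT.
by rewrite adjM !mmulA in sUA *.
Qed.

Lemma supported_gate_conj p G S A :
  pair_set p \subset S \/ [disjoint pair_set p & S] -> qunitary (gate p G) ->
  supported S A -> supported S (gate p G ** A ** adj (gate p G)).
Proof.
move=> [pS _ sA|pS /qunitaryP[_ GG] sA].
  have sG := supported_sub pS (supported_gate p G).
  exact: supported_mul (supported_mul sG sA) (supported_adj sG).
by rewrite (supported_comm (supported_gate p G) sA pS) -mmulA GG mmulm1.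
Qed.

Lemma light_cone_bound_layer L : is_layer L -> light_cone_bound 2 L.
Proof.
move=> [P [U [valid [uni /mat_ext ->]]]].
have gate_uni p : p \in P -> qunitary (gate p (U p)).
  by move=> pP; apply: qunitary_gate (uni p pP); case: valid => + _; exact.
split=> [|S A sA].
  apply: layer_op_ind => // [|p L' pP uniL']; first exact: qunitary_idm.
  exact: qunitary_mul (gate_uni p pP) uniL'.
exists (cone P S); first exact: card_cone.
apply: (layer_op_ind (K := fun L => supported (cone P S) (L ** A ** adj L))) => // [|p L' pP sL'].
  by rewrite adj_idm mmul1m mmulm1; exact: supported_sub (sub_cone P S) sA.
have -> : gate p (U p) ** L' ** A ** adj (gate p (U p) ** L') =
    gate p (U p) ** (L' ** A ** adj L') ** adj (gate p (U p)) by rewrite adjM !mmulA.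
exact: supported_gate_conj (pair_set_cone S valid pP) (gate_uni p pP) sL'.
Qed.

Lemma light_cone_bound_circuit c :
  (forall L, L \in c -> is_layer L) -> light_cone_bound (2 ^ size c) (circuit_op c).
Proof.
elim: c => [_|L c IH layers]; first exact: light_cone_bound_idm.
rewrite expnS; apply: light_cone_bound_mul.
  by apply/light_cone_bound_layer/layers; exact: mem_head.
by apply: IH => L' L'c; apply: layers; rewrite inE L'c orbT.
Qed.

End LightCones.

(** * Entropy of distributions with small marginals *)

Section Entropy.
Variable R : realType.
Implicit Types X I : finType.

Definition distribution X (p : X -> R) := (forall x, 0 <= p x) /\ \sum_x p x = 1.

Lemma gibbs_inequality X (p r : X -> R) :
  distribution p -> distribution r -> (forall x, r x = 0 -> p x = 0) ->
  \sum_x p x * ln (r x) <= \sum_x p x * ln (p x).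
Proof.
move=> [p0 p1] [r0 r1] p_ac_r; rewrite -subr_ge0 -sumrB.
rewrite -[leLHS](subrr 1) -{1}p1 -r1 -sumrB; apply: ler_sum => x _.
move: (p0 x); rewrite le_eqVlt => /predU1P[<-|px]; first by rewrite !mul0r subrr sub0r oppr_le0.
have rx : 0 < r x.
  by rewrite lt_neqAle r0 andbT eq_sym; apply: contraTneq px => /p_ac_r ->; rewrite ltxx.
have tangent : ln (1 + (r x / p x - 1)) <= r x / p x - 1.
  by apply: le_ln1Dx; rewrite ltrBrDr addNr divr_gt0.
rewrite addrC subrK ln_div ?posrE // in tangent.
have -> : p x - r x = - (p x * (r x / p x - 1)) by field; rewrite gt_eqF.
by rewrite -mulrBr -mulrN ler_wpM2l ?p0 // lerNl opprB.
Qed.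

Lemma sum_mul_ln_le X (p : X -> R) (M : R) :
  distribution p -> (forall x, p x <= M) -> \sum_x p x * ln (p x) <= ln M.
Proof.
move=> [p0 p1] pM; rewrite -[leRHS]mul1r -p1 mulr_suml; apply: ler_sum => x _.
move: (p0 x); rewrite le_eqVlt => /predU1P[<-|px]; first by rewrite !mul0r.
by rewrite ler_wpM2l // ler_ln ?posrE // (lt_le_trans px).
Qed.

Lemma ln_prod I (F : I -> R) : (forall i, 0 < F i) -> ln (\prod_i F i) = \sum_i ln (F i).
Proof.
move=> F0; apply/esym; suff : 0 < \prod_i F i /\ \sum_i ln (F i) = ln (\prod_i F i) by case.
elim/big_rec2: _ => [|i s t _ [t0 ->]]; first by rewrite ln1.
by rewrite lnM ?posrE ?mulr_gt0.
Qed.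

Lemma ln2_gt0 : 0 < ln 2 :> R.
Proof. by rewrite ln_gt0 // ltr1n. Qed.

Lemma H2_ln2 (q : R) : H2 q * ln 2 = - (q * ln q) - (1 - q) * ln (1 - q).
Proof. by rewrite /H2 /log2; field; rewrite gt_eqF // ln2_gt0. Qed.

Lemma H2_ge0 (q : R) : 0 <= q <= 1 -> 0 <= H2 q.
Proof.
move=> /andP[q0 q1]; rewrite -(pmulr_lge0 _ ln2_gt0) H2_ln2 -opprD oppr_ge0.
rewrite -[leRHS](addr0 0) lerD // mulr_ge0_le0 ?ln_le0 ?subr_ge0 //.
by rewrite gerBl.
Qed.

Definition bernoulli (q : R) (b : bool) : R := if b then q else 1 - q.

Lemma distribution_bernoulli_prod n (q : R) :
  0 <= q <= 1 -> distribution (fun x : qb n => \prod_i bernoulli q (x i)).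
Proof.
move=> /andP[q0 q1]; split=> [x|].
  by apply: prodr_ge0 => i _; case: (x i) => //=; rewrite subr_ge0.
rewrite -(bigA_distr_bigA (fun=> bernoulli q)) /=.
by apply: big1 => i _; rewrite big_bool /= addrC subrK.
Qed.

Lemma cross_entropy_bernoulli n (p : qb n -> R) (q : R) i :
  distribution p -> \sum_(x : qb n | x i) p x <= q -> 0 <= q <= 1 / 2 ->
  - \sum_x p x * ln (bernoulli q (x i)) <= H2 q * ln 2.
Proof.
move=> [_ p1] pq /andP[q0 q12]; rewrite H2_ln2; set m := (X in X <= q) in pq.
have -> : \sum_x p x * ln (bernoulli q (x i)) = ln (1 - q) + m * (ln q - ln (1 - q)).
  rewrite /m [in RHS]big_mkcond -[X in X + _]mul1r -[X in X * _ + _]p1 !mulr_suml -big_split.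
  by apply: eq_bigr => x _ /=; rewrite /bernoulli; case: (x i) => /=; ring.
have lnq : ln q <= ln (1 - q).
  move: q0; rewrite le_eqVlt => /orP[/eqP <-|q0]; first by rewrite subr0 ln1 ln0.
  by rewrite ler_ln ?posrE; lra.
nra.
Qed.

Lemma min_entropy_le_H2 (n k : nat) (p : qb n -> R) (q : R) :
  distribution p -> (forall x, p x <= (2 ^+ k)^-1) ->
  (forall i, \sum_(x : qb n | x i) p x <= q) -> 0 <= q <= 1 / 2 ->
  k%:R <= n%:R * H2 q.
Proof.
move=> p_dist pk pq q12; have [p0 _] := p_dist.
have q1 : 0 <= q <= 1 by lra.
pose r (x : qb n) := \prod_i bernoulli q (x i).
have bern_gt0 x i : p x != 0 -> 0 < bernoulli q (x i).
  move=> px; rewrite /bernoulli; case: ifP => xi; last by lra.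
  apply: lt_le_trans (pq i); rewrite (bigD1 x) //= ltr_wpDr ?sumr_ge0 //.
  by rewrite lt_neqAle eq_sym px p0.
have p_ac_r x : r x = 0 -> p x = 0.
  move=> rx; apply/eqP; apply: contra_eqT rx => px.
  by rewrite gt_eqF // prodr_gt0 // => i _; exact: bern_gt0.
have ln_r x : p x * ln (r x) = \sum_i p x * ln (bernoulli q (x i)).
  have [->|px] := eqVneq (p x) 0; first by rewrite mul0r big1 // => i _; rewrite mul0r.
  by rewrite -mulr_sumr ln_prod // => i; exact: bern_gt0.
rewrite -(ler_pM2r ln2_gt0) -mulrA.
have -> : k%:R * ln 2 = - ln (2 ^+ k)^-1 :> R.
  by rewrite lnV ?posrE ?exprn_gt0 // opprK lnXn // mulr_natl.
apply: (@le_trans _ _ (- \sum_x p x * ln (r x))).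
  rewrite lerN2; apply: le_trans (sum_mul_ln_le p_dist pk).
  exact: gibbs_inequality (distribution_bernoulli_prod n q1) p_ac_r.
rewrite (eq_bigr _ (fun x _ => ln_r x)) exchange_big -sumrN.
rewrite -[n in n%:R]card_ord mulr_natl -sumr_const; apply: ler_sum => i _.
exact: cross_entropy_bernoulli.
Qed.

End Entropy.

(** * Tensor products and channels *)

Section Channels.
Variable R : realType.
Local Notation C := (R[i]).
Implicit Types X Y Z : finType.

Definition tens X Y (A : mat R X X) (B : mat R Y Y) : mat R (X * Y)%type (X * Y)%type :=
  fun p q => A p.1 q.1 * B p.2 q.2.

Lemma sum_pair X Y (F : X * Y -> C) : \sum_p F p = \sum_x \sum_y F (x, y).
Proof. by rewrite pair_bigA; apply: eq_bigr => -[]. Qed.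

Lemma tens_mul X Y (A A' : mat R X X) (B B' : mat R Y Y) :
  tens A B ** tens A' B' = tens (A ** A') (B ** B').
Proof.
apply: mat_ext => p q; rewrite /mmul /tens big_distrlr /= sum_pair.
by apply: eq_bigr => x _; apply: eq_bigr => y _; rewrite mulrACA.
Qed.

Lemma tens_adj X Y (A : mat R X X) (B : mat R Y Y) : adj (tens A B) = tens (adj A) (adj B).
Proof. by apply: mat_ext => p q; exact: rmorphM. Qed.

Lemma tens_idm X Y : tens (@idm R X) (@idm R Y) = @idm R (X * Y)%type.
Proof. by apply: mat_ext => -[x y] [x' y']; rewrite /tens /idm -natrM mulnb xpair_eqE. Qed.

Lemma psd_tens X Y (A : mat R X X) (B : mat R Y Y) : psd A -> psd B -> psd (tens A B).
Proof.
move=> /psd_is_gram[K ->] /psd_is_gram[L ->]; rewrite -tens_mul -tens_adj; exact: psd_gram.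
Qed.

Lemma reflection_tens X Y (A : mat R X X) (B : mat R Y Y) :
  reflection A -> reflection B -> reflection (tens A B).
Proof. by move=> [Aa AA] [Ba BB]; split; rewrite ?tens_adj ?tens_mul ?Aa ?Ba ?AA ?BB ?tens_idm. Qed.

Lemma projector_tens_idm X Y (Q : mat R X X) : projector Q -> projector (tens Q (@idm R Y)).
Proof. by move=> [Qa QQ]; split; rewrite ?tens_adj ?tens_mul ?Qa ?QQ ?adj_idm ?mmul1m. Qed.

Definition mtrans X Y (A : mat R X Y) : mat R Y X := fun y x => A x y.

Lemma mtrans_mul X Y Z (A : mat R X Y) (B : mat R Y Z) :
  mtrans (A ** B) = mtrans B ** mtrans A.
Proof. by apply: mat_ext => z x; apply: eq_bigr => y _; exact: mulrC. Qed.

Lemma mtrans_idm X : mtrans (@idm R X) = @idm R X.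
Proof. by apply: mat_ext => x x'; rewrite /mtrans /idm eq_sym. Qed.

Lemma reflection_mtrans X (W : mat R X X) : reflection W -> reflection (mtrans W).
Proof.
move=> [Wa WW]; split; last by rewrite -mtrans_mul WW mtrans_idm.
by rewrite -[in RHS]Wa.
Qed.

Definition vect X Y (M : mat R X Y) : vec R (X * Y)%type := fun p => M p.1 p.2.

Lemma mtr_tens_vect X Y (A : mat R X X) (B : mat R Y Y) (M : mat R X Y) :
  mtr (tens A B ** proj (vect M)) = mtr (A ** M ** mtrans B ** adj M).
Proof.
rewrite mtr_mul_proj sum_pair; apply: eq_bigr => x _; apply: eq_bigr => y _.
rewrite sum_pair exchange_big mulr_suml; apply: eq_bigr => y' _.
rewrite !mulr_suml; apply: eq_bigr => x' _.
by rewrite /vect /tens /mtrans /adj /=; ring.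
Qed.

Lemma mtr_proj_vect X Y (M : mat R X Y) : mtr (proj (vect M)) = mtr (M ** adj M).
Proof. by rewrite -[proj _]mmul1m -tens_idm mtr_tens_vect mmul1m mtrans_idm mmulm1. Qed.

Lemma swap_pair_bij X Y : bijective (@swap_pair X Y).
Proof. exact: Bijective swap_pairK swap_pairK. Qed.

Lemma prodA_bij X Y Z : bijective (@prodA X Y Z).
Proof. exact: Bijective (@prodAK X Y Z) (@prodArK X Y Z). Qed.

Definition ptrace_snd X Y (rho : mat R (X * Y)%type (X * Y)%type) : mat R X X :=
  fun x x' => \sum_y rho (x, y) (x', y).

Definition ptrace_fst X Y (rho : mat R (X * Y)%type (X * Y)%type) : mat R Y Y :=
  ptrace_snd (pullback (@swap_pair Y X) rho).

Lemma mtr_tens_ptrace_snd X Y (A : mat R X X) (rho : mat R (X * Y)%type (X * Y)%type) :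
  mtr (tens A (@idm R Y) ** rho) = mtr (A ** ptrace_snd rho).
Proof.
rewrite /mtr /mmul sum_pair; apply: eq_bigr => x _.
under [RHS]eq_bigr do rewrite mulr_sumr; rewrite [RHS]exchange_big; apply: eq_bigr => y _.
rewrite sum_pair; apply: eq_bigr => x' _; rewrite /tens /idm /=.
under eq_bigr do rewrite -mulrA; by rewrite -mulr_sumr sum_delta_l.
Qed.

Lemma mtr_tens_ptrace_fst X Y (B : mat R Y Y) (rho : mat R (X * Y)%type (X * Y)%type) :
  mtr (tens (@idm R X) B ** rho) = mtr (B ** ptrace_fst rho).
Proof.
rewrite -mtr_tens_ptrace_snd -(mtr_pullback _ (@swap_pair_bij Y X)).
rewrite pullback_mul; last exact: swap_pair_bij.
by congr (mtr (_ ** _)); apply: mat_ext => p q; exact: mulrC.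
Qed.

Lemma psd_ptrace_snd X Y (rho : mat R (X * Y)%type (X * Y)%type) : psd rho -> psd (ptrace_snd rho).
Proof.
move=> rho0; apply/psdP => v; rewrite mtrC -mtr_tens_ptrace_snd.
have [K ->] := psd_is_gram (psd_tens (psd_proj v) (@psd_idm R Y)).
exact: mtr_gram_mul_ge0.
Qed.

Lemma psd_ptrace_fst X Y (rho : mat R (X * Y)%type (X * Y)%type) : psd rho -> psd (ptrace_fst rho).
Proof. by move=> rho0; exact/psd_ptrace_snd/psd_pullback. Qed.

Lemma cptp_linear X Y (M : chan R X Y) : cptp M -> linear M.
Proof. by case=> M_lin _ c A B; apply: mat_ext => y y'; exact: M_lin. Qed.

Lemma cptp_sum X Y I (r : seq I) (M : chan R X Y) (F : I -> mat R X X) :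
  cptp M -> M (\sum_(i <- r) F i) = \sum_(i <- r) M (F i).
Proof.
move=> /cptp_linear M_lin.
pose f := GRing.isLinear.Build C (mat R X X) (mat R Y Y) _ M M_lin.
pose L : {linear mat R X X -> mat R Y Y} := HB.pack M f.
exact: (linear_sum L).
Qed.

Lemma ptrace_fst_ext X Y Z (M : chan R X Y) (rho : mat R (X * Z)%type (X * Z)%type) :
  cptp M -> ptrace_fst (ext M rho) = ptrace_fst rho.
Proof.
move=> [_ [M_tr _]]; apply: mat_ext => z z'.
exact: (M_tr (fun x x' => rho (x, z) (x', z'))).
Qed.

Lemma density_proj X (v : vec R X) : unit_vec v -> density (proj v).
Proof. by move=> /unit_vecP v1; split => //; exact: psd_proj. Qed.

Lemma cptp_replace X Y (sigma : mat R Y Y) :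
  density sigma -> cptp (fun rho : mat R X X => mtr rho *: sigma).
Proof.
move=> [sigma0 sigma1]; split=> [c A B y y'|].
  by rewrite -[madd _ _]/(c *: A + B) linearP scalerDl -scalerA.
split=> [A|Z rho rho0]; first by rewrite linearZ /= sigma1 [LHS]mulr1.
have := psd_tens sigma0 (psd_ptrace_fst rho0); congr psd.
by apply: mat_ext => p q; rewrite /tens mulrC.
Qed.

Lemma pdist_ge0 X Y (M1 M2 : chan R X Y) : 0 <= pdist M1 M2.
Proof. exact: sqrtr_ge0. Qed.

Lemma pdist_le1 X Y (M1 M2 : chan R X Y) : pdist M1 M2 <= 1.
Proof. by rewrite /pdist -[leRHS]sqrtr1 ler_wsqrtr // lerBlDr lerDl sqr_ge0. Qed.

Lemma pdist_ge X Y (M1 M2 : chan R X Y) (rho : mat R (X * X)%type (X * X)%type) :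
  density rho -> Num.sqrt (1 - fid (ext M1 rho) (ext M2 rho) ^+ 2) <= pdist M1 M2.
Proof.
move=> rho_density; rewrite ler_wsqrtr // lerB //.
have fids_lb : lbound [set fid (ext M1 rho) (ext M2 rho) |
    rho in [set rho : mat R (X * X)%type (X * X)%type | density rho]]%classic 0.
  by move=> _ [sigma _ <-]; exact: fid_ge0.
rewrite lerXn2r ?nnegrE ?fid_ge0 //; last by apply: ge_inf; [exists 0|exists rho].
by apply: lb_le_inf => //; exists (fid (ext M1 rho) (ext M2 rho)), rho.
Qed.

Lemma pdist_id_ge X (M : chan R X X) (v : vec R (X * X)%type) :
  unit_vec v -> psd (ext M (proj v)) ->
  Num.sqrt (1 - expect (ext M (proj v)) (proj v)) <= pdist M (fun rho => rho).
Proof.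
move=> v1 Mv0; apply: le_trans (pdist_ge _ _ (density_proj v1)).
have -> : ext (fun rho => rho) (proj v) = proj v by apply: mat_ext => -[x y] [x' y'].
have [K vE] := psd_is_gram (psd_proj v).
by rewrite fid_proj // sqr_sqrtr // {2}vE expect_gram_ge0.
Qed.

Lemma qec_inacc_ge L P (N : chan R P P) (E : chan R L P) (l : L) (t : R) :
  (forall Rc, cptp Rc -> t <= pdist (fun rho => Rc (N (E rho))) (fun rho => rho)) ->
  t <= qec_inacc N E.
Proof.
move=> t_le; apply: lb_le_inf; last by move=> _ [Rc /t_le tRc <-].
have Rc_cptp := cptp_replace P (density_proj (unit_vec_ket R l)).
by eexists; eexists; first exact: Rc_cptp.
Qed.

Lemma qec_inacc_le1 L P (N : chan R P P) (E : chan R L P) (l : L) : qec_inacc N E <= 1.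
Proof.
have Rc_cptp := cptp_replace P (density_proj (unit_vec_ket R l)).
apply: le_trans (pdist_le1 (fun rho => mtr (N (E rho)) *: proj (ket R l)) (fun rho => rho)).
by apply: ge_inf; [exists 0 => _ [Rc _ <-]; exact: pdist_ge0|eexists; first exact: Rc_cptp].
Qed.

End Channels.

(** * Recovery from the erasure of a set of qubits *)

Section Erasure.
Variables (R : realType) (n : nat) (S : {set 'I_n}).
Local Notation zero_block := ([ffun=> false] : subq S).
Implicit Type L : finType.

(* An isometric dilation of the replacement of [S] by zeroes: the old content of [S] is
   handed over to the environment [subq S]. *)
Definition erase L (A : mat R (qb n) L) : mat R (qb n) (L * subq S)%type :=
  fun x p => A (glue p.2 x) p.1 * (restr S x == zero_block)%:R.

Lemma repl_outer L (A : mat R (qb n) L) l l' :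
  repl (proj (ket R zero_block)) (fun x x' => A x l * Num.conj (A x' l')) =
  \sum_r (fun x x' => erase A x (l, r) * Num.conj (erase A x' (l', r))).
Proof.
apply: mat_ext => x x'; rewrite /repl ptr_setC mulr_suml !fct_sumE.
by apply: eq_bigr => r _; rewrite /erase /proj /ket /= rmorphM /=; ring.
Qed.

Lemma mtr_erase L (A : mat R (qb n) L) (Y : mat R L L) (v : mat R (subq S) (subq S)) :
  mtr (erase A ** tens Y v ** adj (erase A)) = mtr (embed (mtrans v) ** A ** Y ** adj A).
Proof.
rewrite -!mmulA /mtr; under [RHS]eq_bigr do rewrite embed_mulE.
rewrite [RHS](sum_restr zero_block) -[RHS]sum_indicator; apply: eq_bigr => x _.
rewrite [RHS]mulr_sumr; under [RHS]eq_bigr do rewrite mulr_sumr.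
rewrite [RHS]exchange_big [LHS]sum_pair [LHS]exchange_big; apply: eq_bigr => r' _.
under [RHS]eq_bigr do rewrite restr_glue glue_glue /mmul mulrA mulr_sumr.
rewrite [RHS]exchange_big; apply: eq_bigr => l' _.
rewrite /mmul sum_pair exchange_big mulr_sumr; apply: eq_bigr => r _.
rewrite !mulr_sumr; apply: eq_bigr => l _.
rewrite /adj /erase /tens /mtrans /= rmorphM /= rmorph_nat.
by case: (restr S x == _); rewrite ?mulr1 ?mul1r ?mulr0 ?mul0r //; ring.
Qed.

End Erasure.

Section Recovery.
Variables (R : realType) (n k : nat) (V : mat R (qb n) (qb k)) (S : {set 'I_n}).
Local Notation zero_block := ([ffun=> false] : subq S).
Variable Rc : chan R (qb n) (qb k).
Hypotheses (V_iso : qisometry V) (Rc_cptp : cptp Rc).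
Implicit Type Z : finType.

Definition noisy_recovery : chan R (qb k) (qb k) :=
  fun rho => Rc (repl (proj (ket R zero_block)) (enc V rho)).

(* The joint state of the recovered system, the reference [Z] and the erased block, when the
   input is the pure state with coefficient matrix [M]. *)
Definition recovered_state Z (M : mat R (qb k) Z) :
    mat R ((qb k * Z) * subq S)%type ((qb k * Z) * subq S)%type :=
  pullback (@prodA _ _ _) (ext Rc (proj (vect (erase (V ** M))))).

Lemma enc_outer Z (M : mat R (qb k) Z) z z' :
  enc V (fun m m' => M m z * Num.conj (M m' z')) =
  (fun x x' => (V ** M) x z * Num.conj ((V ** M) x' z')).
Proof.
apply: mat_ext => x x'; rewrite /enc /mmul /adj rmorph_sum mulr_sumr.
apply: eq_bigr => m' _; rewrite !mulr_suml; apply: eq_bigr => m _.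
by rewrite rmorphM /=; ring.
Qed.

Lemma ptrace_recovered_state Z (M : mat R (qb k) Z) :
  ptrace_snd (recovered_state M) = ext noisy_recovery (proj (vect M)).
Proof.
apply: mat_ext => -[m z] [m' z']; rewrite /ext /noisy_recovery /=.
by rewrite -[fun _ _ => proj _ _ _]/(fun l l' => M l z * Num.conj (M l' z')) enc_outer repl_outer
  cptp_sum // !fct_sumE.
Qed.

Lemma mtr_recovered_state Z (M : mat R (qb k) Z) (Y : mat R Z Z) (v : mat R (subq S) (subq S)) :
  mtr (tens (tens (@idm R (qb k)) (mtrans Y)) v ** recovered_state M) =
  mtr (embed v ** (V ** (M ** Y ** adj M) ** adj V)).
Proof.
have -> : tens (tens (@idm R (qb k)) (mtrans Y)) v =
    pullback (@prodA _ _ _) (tens (@idm R (qb k)) (tens (mtrans Y) v)).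
  by apply: mat_ext => p q; rewrite /tens /pullback mulrA.
rewrite -pullback_mul ?mtr_pullback; try exact: prodA_bij.
rewrite mtr_tens_ptrace_fst ptrace_fst_ext // -mtr_tens_ptrace_fst mtr_tens_vect mmul1m.
rewrite -[mtrans (tens _ _)]/(tens Y (mtrans v)) mtr_erase -[mtrans (mtrans v)]/v.
by rewrite adjM !mmulA.
Qed.

Lemma density_recovered_state Z (M : mat R (qb k) Z) :
  mtr (M ** adj M) = 1 -> density (recovered_state M).
Proof.
move=> M1; split.
  have [_ [_ Rc_psd]] := Rc_cptp; exact/psd_pullback/Rc_psd/psd_proj.
rewrite -[recovered_state M]mmul1m -!tens_idm -[X in tens (tens _ X)]mtrans_idm mtr_recovered_state.
by rewrite embed_idm mmul1m mmulm1 mtrC !mmulA ((qisometryP V).1 V_iso) mmul1m.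
Qed.

Lemma recovery_correlation_le (M Y : mat R (qb k) (qb k)) (w : mat R (subq S) (subq S)) :
  mtr (M ** adj M) = 1 -> reflection Y -> mtr (M ** Y ** adj M) = 0 -> reflection w ->
  expect (V ** (M ** Y ** adj M) ** adj V) (embed w) <= 2 * pdist noisy_recovery (fun rho => rho).
Proof.
move=> M1 Y_refl MYM w_refl; pose tau := recovered_state M.
have Omega1 : unit_vec (vect M) by apply/unit_vecP; rewrite mtr_proj_vect.
pose T := tens (tens (@idm R (qb k)) (mtrans Y)) w.
pose Q := tens (proj (vect M)) (@idm R (subq S)).
have tau_density : density tau := density_recovered_state M1.
have T_refl : reflection T.
  by do !apply: reflection_tens => //; [exact: reflection_idm|exact: reflection_mtrans].
have Q_proj : projector Q := projector_tens_idm _ (projector_proj Omega1).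
have QTQ : Q ** T ** Q = 0.
  rewrite !tens_mul proj_sandwich mtr_tens_vect mmul1m -[mtrans (mtrans Y)]/Y MYM scale0r.
  by apply: mat_ext => p q; exact: mul0r.
rewrite {1}/expect -mtr_recovered_state.
apply: le_trans (expect_decoupling tau_density T_refl Q_proj QTQ) _; rewrite ler_pM2l //.
rewrite {1}/expect /Q mtr_tens_ptrace_snd ptrace_recovered_state; apply: pdist_id_ge => //.
by rewrite -ptrace_recovered_state; apply: psd_ptrace_snd; case: tau_density.
Qed.

End Recovery.

(** * The balanced test state *)

Section Split.
Variables (R : realType) (X : finType) (phi : vec R X).
Hypothesis phi1 : unit_vec phi.
Local Notation D := (#|X|%:R : R).

Definition split_op (a b : R) : mat R X X := a%:C%C *: proj phi + b%:C%C *: (@idm R X - proj phi).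

Lemma split_op_adj a b : adj (split_op a b) = split_op a b.
Proof. by rewrite adjD !adjZ !conj_real adjB adj_idm adj_proj. Qed.

Lemma split_op_mul a b a' b' : split_op a b ** split_op a' b' = split_op (a * a') (b * b').
Proof.
have Q_proj := projector_proj phi1; have [[_ QQ] [_ BB]] := (Q_proj, projector_compl Q_proj).
have QB : proj phi ** (@idm R X - proj phi) = 0 by rewrite mmulBr mmulm1 QQ subrr.
have BQ : (@idm R X - proj phi) ** proj phi = 0 by rewrite mmulBl mmul1m QQ subrr.
rewrite mmulDl !mmulDr !(mmulZl, mmulZr) QQ QB BQ BB !scaler0 addr0 add0r.
by rewrite !scalerA -!rmorphM.
Qed.

Lemma split_op11 : split_op 1 1 = @idm R X.
Proof. by rewrite /split_op !scale1r addrC subrK. Qed.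

Lemma mtr_split_op a b : mtr (split_op a b) = (a + b * (D - 1))%:C%C.
Proof.
rewrite linearD !linearZ linearB /= mtr_idm (unit_vecP phi).1 // mulr1.
by rewrite rmorphD rmorphM rmorphB rmorph1 rmorph_nat.
Qed.

Lemma reflection_split_op : reflection (split_op 1 (-1)).
Proof. by split; rewrite ?split_op_adj // split_op_mul mulr1 mulrNN mulr1 split_op11. Qed.

(* [a = b * (D - 1)] says that [phi] and its complement carry equal weights. *)
Lemma split_op_balanced a b : (0 < #|X|)%N -> a = b * (D - 1) ->
  split_op a (- b) = (a + b)%:C%C *: (proj phi - (D^-1)%:C%C *: @idm R X).
Proof.
move=> X0 ab; have D0 : D != 0 by rewrite pnatr_eq0 -lt0n.
have bE : b = (a + b) * D^-1 by rewrite ab; field.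
rewrite scalerBr scalerA -rmorphM -bE /split_op rmorphN scaleNr scalerBr opprB addrA.
by rewrite -scalerDl -rmorphD.
Qed.

Lemma balanced_test_state : (1 < #|X|)%N -> exists (M : mat R X X) (c : R),
  [/\ 1 / 2 <= c, mtr (M ** adj M) = 1
    & M ** split_op 1 (-1) ** adj M = c%:C%C *: (proj phi - (D^-1)%:C%C *: @idm R X)].
Proof.
move=> X1; have D1 : 0 < D - 1 by rewrite subr_gt0 ltr1n.
pose a : R := Num.sqrt (1 / 2); pose b : R := Num.sqrt ((D - 1)^-1 / 2).
have aa : a * a = 1 / 2 by rewrite -expr2 sqr_sqrtr.
have bb : b * b * (D - 1) = 1 / 2.
  by rewrite -expr2 sqr_sqrtr; [field; rewrite gt_eqF|rewrite divr_ge0 // invr_ge0 ltW].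
exists (split_op a b), (a * a + b * b); split.
- by rewrite aa lerDl -expr2 sqr_ge0.
- by rewrite split_op_adj split_op_mul mtr_split_op aa bb -splitr.
rewrite split_op_adj !split_op_mul mulr1 mulrN1 mulNr split_op_balanced ?aa ?bb //.
exact: ltnW.
Qed.

End Split.

(** * Local indistinguishability of code states *)

Section CodeStates.
Variables (R : realType) (n : nat).
Local Notation C := (R[i]).
Implicit Types (k d : nat) (S : {set 'I_n}).

Definition locally_close d (e : R) (rho sigma : mat R (qb n) (qb n)) :=
  forall S W, (#|S| <= d)%N -> supported S W -> reflection W -> expect (rho - sigma) W <= e.

Lemma locally_close_ge0 d e rho sigma :
  mtr rho = mtr sigma -> locally_close d e rho sigma -> 0 <= e.
Proof.
move=> tr_eq /(_ finset.set0 (@idm R (qb n))); rewrite cards0 expectBl /expect !mmul1m tr_eq subrr.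
by apply=> //; [exact: supported_idm|exact: reflection_idm].
Qed.

Lemma GamE k (V : mat R (qb n) (qb k)) : Gam V = (2 ^+ k)^-1 *: (V ** adj V).
Proof. by []. Qed.

Lemma card_qb m : #|{: qb m}| = (2 ^ m)%N.
Proof. by rewrite card_ffun card_bool card_ord. Qed.

Section Code.
Variables (k : nat) (V : mat R (qb n) (qb k)).
Hypothesis V_iso : qisometry V.

Lemma mtr_code_state psi : code_state V psi -> mtr (proj psi) = 1.
Proof.
move=> [phi [/unit_vecP phi1 ->]].
by rewrite proj_mapply mtrC mmulA ((qisometryP V).1 V_iso) mmul1m.
Qed.

Lemma mtr_Gam : mtr (Gam V) = 1.
Proof.
rewrite GamE linearZ /= mtrC ((qisometryP V).1 V_iso) mtr_idm card_qb natrX.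
by rewrite mulVf // expf_neq0.
Qed.

Lemma code_state_entry_le1 psi x : code_state V psi -> `|psi x| <= 1.
Proof.
move=> /mtr_code_state; rewrite /mtr (bigD1 x) //= => psi1.
rewrite -(@expr_le1 _ 2) // normCK -psi1 lerDl; apply: sumr_ge0 => y _.
exact: mul_conjC_ge0.
Qed.

Lemma norm_ptr_le S (A : mat R (qb n) (qb n)) (r s : subq S) :
  `|ptr A r s| <= \sum_x \sum_y `|A x y|.
Proof.
rewrite ptrE exchange_big; apply: le_trans (ler_norm_sum _ _ _) _.
rewrite big_mkcond; apply: ler_sum => y _; case: ifP => _; last exact: sumr_ge0.
by rewrite (bigD1 (glue r y)) //= lerDl sumr_ge0.
Qed.

Lemma eps_g_has_ubound d : has_ubound [set r : R | exists (psi : vec R (qb n)) S,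
  code_state V psi /\ (#|S| <= d)%N /\
  r = trnorm (msub (ptr (S := S) (proj psi)) (ptr (Gam V)))]%classic.
Proof.
pose K : C := \sum_x \sum_y (1 + `|Gam V x y|).
have K0 : 0 <= K by apply: sumr_ge0 => x _; apply: sumr_ge0 => y _; rewrite addr_ge0.
pose F S : R := #|{: subq S}|%:R * (1 + #|{: subq S}|%:R * Re K ^+ 2).
have F0 S : 0 <= F S by rewrite mulr_ge0 // addr_ge0 // mulr_ge0 // sqr_ge0.
exists (\sum_S F S) => _ [psi [S [psiV [_ ->]]]].
apply: (@le_trans _ _ (F S)); last by rewrite (bigD1 S) //= lerDl sumr_ge0.
apply: trnorm_le_entries => r s; rewrite ge0_ReK //.
have -> : msub (ptr (proj psi)) (ptr (Gam V)) r s = ptr (proj psi - Gam V) r s by rewrite ptrB.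
apply: le_trans (norm_ptr_le _ _ _) _; apply: ler_sum => x _; apply: ler_sum => y _.
apply: le_trans (ler_normB _ _) _; rewrite lerD2r normrM norm_conjC.
by rewrite mulr_ile1 // code_state_entry_le1.
Qed.

Lemma locally_close_eps_g d psi :
  code_state V psi -> locally_close d (eps_g V d) (proj psi) (Gam V).
Proof.
move=> psiV S W Sd [w ->] /reflection_embed w_refl; rewrite expect_ptr ptrB.
apply: le_trans (expect_le_trnorm _ (reflection_qunitary w_refl)) _.
by apply: (ub_le_sup (eps_g_has_ubound d)); exists psi, S.
Qed.

Let zero_code : qb k := [ffun=> false].

Lemma qec_inacc_le_max d S (gamma : mat R (subq S) (subq S)) :
  (#|S| <= d)%N -> density gamma -> qec_inacc (repl gamma) (enc V) <= max_repl_inacc V d.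
Proof.
move=> Sd gamma_density; apply: ub_le_sup; last by exists S, gamma.
by exists 1 => _ [S' [gamma' [_ [_ ->]]]]; exact: qec_inacc_le1 zero_code.
Qed.

Lemma pdist_recovery_le d S (t : R) : (#|S| <= d)%N ->
  (forall Rc, cptp Rc -> t <= pdist (noisy_recovery V S Rc) (fun rho => rho)) ->
  t <= max_repl_inacc V d.
Proof.
move=> Sd t_le; apply: le_trans (qec_inacc_ge zero_code t_le) _.
by apply: qec_inacc_le_max => //; exact/density_proj/unit_vec_ket.
Qed.

Lemma max_repl_inacc_ge0 d : 0 <= max_repl_inacc V d.
Proof.
apply: (@pdist_recovery_le _ finset.set0) => [|Rc _]; first by rewrite cards0.
exact: pdist_ge0.
Qed.

Lemma locally_close_max_repl_inacc d psi :
  (0 < k)%N -> code_state V psi -> locally_close d (4 * max_repl_inacc V d) (proj psi) (Gam V).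
Proof.
move=> k0 [phi [phi1 ->]] S W Sd [w ->] /reflection_embed w_refl.
have [|M [c [c12 M1 MYM]]] := balanced_test_state phi1.
  by rewrite card_qb -[1%N]/(2 ^ 0)%N ltn_exp2l.
have MYM0 : mtr (M ** split_op phi 1 (-1) ** adj M) = 0.
  rewrite MYM linearZ linearB linearZ /= mtr_idm ((unit_vecP phi).1 phi1).
  by rewrite fmorphV rmorph_nat mulVf ?subrr ?mulr0 // card_qb natrX expf_neq0.
set t := expect _ _; suff : t / 4 <= max_repl_inacc V d by lra.
apply: (pdist_recovery_le Sd) => Rc Rc_cptp.
have := recovery_correlation_le V_iso Rc_cptp M1 (reflection_split_op phi1) MYM0 w_refl.
have -> : V ** (M ** split_op phi 1 (-1) ** adj M) ** adj V =
    c%:C%C *: (proj (mapply V phi) - Gam V).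
  rewrite MYM mmulZr mmulZl mmulBr mmulBl mmulZr mmulZl mmulm1 proj_mapply GamE.
  by rewrite card_qb natrX fmorphV rmorphXn rmorph_nat.
rewrite expectZl -/t => corr.
have := pdist_ge0 (noisy_recovery V S Rc) (fun rho => rho).
by have [t0|t0] := leP t 0; nra.
Qed.

End Code.
End CodeStates.

(** * Shallow circuits *)

Section ShallowCircuits.
Variables (R : realType) (n : nat).
Implicit Types (k d : nat) (i : 'I_n) (U : mat R (qb n) (qb n)).

Definition pauliZ i : mat R (qb n) (qb n) := diagm (fun x : qb n => (-1) ^+ x i).

Lemma reflection_pauliZ i : reflection (pauliZ i).
Proof.
split; first exact: adj_diagm.
rewrite diagm_mul; apply: mat_ext => x y; rewrite /diagm /idm -expr2 sqrr_sign.
by rewrite rmorph1 mul1r.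
Qed.

Lemma supported_pauliZ i : supported [set i]%SET (pauliZ i).
Proof.
exists (diagm (fun r : subq [set i]%SET => (-1) ^+ r (exist _ i (set11 i)))).
apply: mat_ext => x y; rewrite /embed /pauliZ /diagm (qb_eqE [set i]%SET) ffunE.
by rewrite -mulnb natrM; ring.
Qed.

Lemma expect_pauliZ i rho :
  expect rho (pauliZ i) = Re (mtr rho) - 2 * \sum_(x : qb n | x i) Re (rho x x).
Proof.
rewrite /expect /mtr !raddf_sum mulr_sumr [X in _ - X]big_mkcond -sumrB.
apply: eq_bigr => x _; have -> : (pauliZ i ** rho) x x = ((-1) ^+ x i)%:C%C * rho x x.
  by rewrite /mmul /pauliZ /diagm; under eq_bigr do rewrite -mulrA; rewrite -mulr_sumr sum_delta_l.
by rewrite /= Re_realM; case: (x i); rewrite ?expr1 ?expr0; lra.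
Qed.

Lemma distribution_Gam k (V : mat R (qb n) (qb k)) :
  qisometry V -> distribution (fun x => Re (Gam V x x)).
Proof.
move=> V_iso; split=> [x|]; last by rewrite -raddf_sum -/(mtr _) mtr_Gam.
apply: Re_ge0; rewrite GamE; apply: mulr_ge0; first by rewrite invr_ge0 exprn_ge0.
by have := psd_diag_ge0 x (psd_gram (adj V)); rewrite adjK.
Qed.

Lemma Gam_diag_le k (V : mat R (qb n) (qb k)) x :
  qisometry V -> Re (Gam V x x) <= (2 ^+ k)^-1.
Proof.
move=> /qisometryP V_iso.
have -> : Re (Gam V x x) = (2 ^+ k)^-1 * Re ((V ** adj V) x x).
  by rewrite -Re_realM fmorphV rmorphXn rmorph_nat.
rewrite ler_piMr ?invr_ge0 ?exprn_ge0 //.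
have := expect_cauchy_schwarz (@idm R (qb n)) (V ** adj V) (psd_proj (ket R x)).
rewrite !expect_ket adj_idm !mmul1m adjM adjK -!mmulA (mmulA (adj V)) V_iso mmul1m.
by rewrite /idm eqxx mul1r /=; nra.
Qed.

Lemma code_dimension_le_entropy k (V : mat R (qb n) (qb k)) U psi m d (e delta : R) :
  qisometry V -> light_cone_bound m U -> (m <= d)%N -> locally_close d (2 * e) (proj psi) (Gam V) ->
  trnorm (proj (mapply U (@zero_state R n)) - proj psi) <= delta ->
  0 <= e + delta / 2 <= 1 / 2 -> k%:R <= n%:R * H2 (e + delta / 2).
Proof.
move=> V_iso [U_uni U_cone] md psi_close near q12; have [UaU UUa] := (qunitaryP U).1 U_uni.
pose V' := adj U ** V.
have V'_iso : qisometry V'.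
  by apply: qisometry_mul V_iso; apply/qisometryP; rewrite adjK.
apply: min_entropy_le_H2 (distribution_Gam V'_iso) _ _ q12 => [x|i]; first exact: Gam_diag_le.
set marginal := \sum_(x | _) _; pose W := U ** pauliZ i ** adj U.
have W_refl : reflection W := reflection_conj U_uni (reflection_pauliZ i).
have [S] := U_cone _ _ (supported_pauliZ i); rewrite cards1 muln1 => Sm W_supp.
have expect_zero : expect (proj (mapply U (@zero_state R n))) W = 1.
  rewrite expect_conj proj_mapply !mmulA UaU mmul1m -mmulA UaU mmulm1.
  by rewrite /expect mtr_mul_proj_ket /pauliZ /diagm eqxx ffunE expr0 mulr1.
have expect_Gam : expect (Gam V) W = 1 - 2 * marginal.
  rewrite expect_conj; have -> : adj U ** Gam V ** U = Gam V'.
    by rewrite !GamE mmulZr mmulZl adjM adjK !mmulA.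
  by rewrite expect_pauliZ mtr_Gam.
have := psi_close S W (leq_trans Sm md) W_supp W_refl.
have := le_trans (expect_le_trnorm _ (reflection_qunitary W_refl)) near.
by rewrite !expectBl expect_zero expect_Gam; lra.
Qed.

Lemma log2_lt_circ_cplx d (delta : R) (psi : vec R (qb n)) : (0 < d)%N ->
  (forall c, (forall L, L \in c -> is_layer L) ->
     trnorm (proj (run c) - proj psi) <= delta -> (d < 2 ^ size c)%N) ->
  ((log2 (d%:R : R))%:E < circ_cplx delta psi)%E.
Proof.
move=> d0 deep; apply: (@lt_le_trans _ _ ((trunc_log 2 d).+1%:R)%:E).
  rewrite lte_fin /log2 ltr_pdivrMr ?ln2_gt0 // mulr_natl -lnXn //.
  by rewrite ltr_ln ?posrE ?ltr0n ?exprn_gt0 // -natrX ltr_nat trunc_log_ltn.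
apply: le_ereal_inf_tmp => _ [c [layers near] <-]; rewrite lee_fin ler_nat.
by rewrite -(@ltn_exp2l 2) //; apply: leq_ltn_trans (deep c layers near); exact: trunc_logP.
Qed.

End ShallowCircuits.

Theorem theorem3 (R : realType) (n k : nat) (V : mat R (qb n) (qb k))
  (d : nat) (delta : R) :
  (k < n)%N -> qisometry V -> (1 <= d)%N -> 0 <= delta ->
  ((eps_g V d / 2 + delta / 2 < 1 / 2 /\
      H2 (eps_g V d / 2 + delta / 2) < k%:R / n%:R)
   \/
   (2 * max_repl_inacc V d + delta / 2 < 1 / 2 /\
      H2 (2 * max_repl_inacc V d + delta / 2) < k%:R / n%:R)) ->
  forall psi : vec R (qb n), code_state V psi ->
    ((log2 (d%:R : R))%:E < circ_cplx delta psi)%E.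
Proof.
move=> kn V_iso d1 delta0 hyp psi psiV.
have n0 : 0 < n%:R :> R by rewrite ltr0n (leq_ltn_trans _ kn).
have [e [psi_close q12 H2_lt]] : exists e : R, [/\ locally_close d (2 * e) (proj psi) (Gam V),
    e + delta / 2 < 1 / 2 & H2 (e + delta / 2) < k%:R / n%:R].
  case: hyp => -[q12 H2_lt].
    exists (eps_g V d / 2); split=> //.
    by rewrite mulrC divfK //; exact: locally_close_eps_g.
  have inacc0 := max_repl_inacc_ge0 V d.
  exists (2 * max_repl_inacc V d); split=> //; rewrite mulrA -natrM.
  apply: locally_close_max_repl_inacc psiV => //.
  have : 0 < k%:R / n%:R :> R by apply: le_lt_trans H2_lt; apply: H2_ge0; lra.
  by rewrite pmulr_lgt0 ?invr_gt0 // ltr0n.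
have e0 : 0 <= 2 * e.
  by apply: locally_close_ge0 psi_close; rewrite mtr_Gam // (mtr_code_state V_iso psiV).
apply: log2_lt_circ_cplx => // c layers near; rewrite ltnNge; apply/negP => shallow.
suff : k%:R <= n%:R * H2 (e + delta / 2) by rewrite leNgt mulrC -ltr_pdivlMr // H2_lt.
rewrite run_circuit_op in near; have cone := light_cone_bound_circuit layers.
by apply: (code_dimension_le_entropy V_iso cone shallow psi_close near); lra.
Qed.
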